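(* Let $(X_0,X_1)$ and $(Y_0,Y_1)$ be couples of Banach lattices with the Fatou property (on $\sigma$-finite measure spaces) and let $T:(X_0,X_1)\to(Y_0,Y_1)$ be a positive operator. Assume that $T:X_0^{1-\theta_0}X_1^{\theta_0}\to Y_0^{1-\theta_0}Y_1^{\theta_0}$ is an order isomorphism for some $\theta_0\in(0,1)$. Then $T:X_0^{1-\theta_1}X_1^{\theta_1}\to Y_0^{1-\theta_1}Y_1^{\theta_1}$ is an order isomorphism for every $\theta_1\in(0,1)$.
   Context: A Banach lattice on a $\sigma$-finite measure space $(\Omega,\Sigma,\mu)$ is a Banach space $X\subset L^0(\mu)$ containing a $\mu$-a.e. strictly positive element and solid: if $f\in L^0(\mu)$, $g\in X$, $|f|\le|g|$ a.e., then $f\in X$ and $\|f\|_X\le\|g\|_X$. Fatou property: if $0\le f_n\uparrow f$ a.e. with $f_n\in X$ and $\sup_n\|f_n\|_X<\infty$, then $f\in X$ and $\|f_n\|_X\uparrow\|f\|_X$. The Calderón product $X_0^{1-\theta}X_1^\theta$ consists of $f\in L^0(\mu)$ with $|f|\le\lambda|f_0|^{1-\theta}|f_1|^\theta$ a.e. for some $\lambda>0$ and $\|f_j\|_{X_j}\le1$, normed by the infimum of such $\lambda$. An operator $T:(X_0,X_1)\to(Y_0,Y_1)$ is a linear map $X_0+X_1\to Y_0+Y_1$ bounded $X_j\to Y_j$; it is positive if $Tf\ge0$ whenever $f\ge0$. An order isomorphism between Banach lattices is a linear bijection $T$ such that $T$ and $T^{-1}$ are both positive (equivalently, a bijective lattice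 homomorphism). *)

(* Defs.v *)
From HB Require Import structures.
From mathcomp Require Import all_boot all_order all_algebra.
From mathcomp Require Import all_classical all_reals all_analysis.
Set Implicit Arguments. Unset Strict Implicit. Unset Printing Implicit Defensive.
Import Order.TTheory GRing.Theory Num.Theory numFieldNormedType.Exports.
Local Open Scope classical_set_scope.
Local Open Scope ring_scope.

(* A (quasi) Banach function lattice on (Omega, mu) is represented, as usual
   (Lorentz-Luxemburg "function norm"), by an extended-real valued functional
   N on functions Omega -> R; the space itself is
   X = { f in L^0(mu) | N f < +oo }.  Elements of L^0 are measurable
   functions, identified up to mu-a.e. equality (all conditions below are
   a.e.-invariant). *)

Section Defs.
Context (R : realType).

Definition aeeq d (T : measurableType d) (mu : {measure set T -> \bar R})
  (f g : T -> R) := {ae mu, forall x, f x = g x}.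

Definition ae_nonneg d (T : measurableType d) (mu : {measure set T -> \bar R})
  (f : T -> R) := {ae mu, forall x, 0 <= f x}.

Definition mem_sp d (T : measurableType d) (N : (T -> R) -> \bar R)
  (f : T -> R) := measurable_fun setT f /\ (N f < +oo)%E.

Definition banach_lattice d (T : measurableType d)
  (mu : {measure set T -> \bar R}) (N : (T -> R) -> \bar R) : Prop :=
  [/\
      (forall f : T -> R, measurable_fun setT f -> (0 <= N f)%E) /\
      (forall f : T -> R, measurable_fun setT f -> (N f = 0%E <-> aeeq mu f (fun=> 0))) /\
      (forall (c : R) (f : T -> R), measurable_fun setT f ->
         N (fun x => c * f x)%R = (`|c|%:E * N f)%E),
      (forall f g : T -> R, measurable_fun setT f -> measurable_fun setT g ->
         (N (fun x => f x + g x)%R <= N f + N g)%E),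
      (forall f g : T -> R, measurable_fun setT f -> measurable_fun setT g ->
         {ae mu, forall x, `|f x| <= `|g x|} -> (N f <= N g)%E),
      (exists w, mem_sp N w /\ {ae mu, forall x, 0 < w x}) &
      (forall u : nat -> T -> R, (forall n, mem_sp N (u n)) ->
         (forall eps : R, 0 < eps -> exists M, forall n m, (M <= n)%N -> (M <= m)%N ->
            (N (fun x => u n x - u m x)%R <= eps%:E)%E) ->
         exists f, mem_sp N f /\
           (forall eps : R, 0 < eps -> exists M, forall n, (M <= n)%N ->
              (N (fun x => u n x - f x)%R <= eps%:E)%E))].

Definition fatou_property d (T : measurableType d)
  (mu : {measure set T -> \bar R}) (N : (T -> R) -> \bar R) : Prop :=
  forall (u : nat -> T -> R) (f : T -> R),
    measurable_fun setT f ->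
    (forall n, mem_sp N (u n)) ->
    {ae mu, forall x, (forall n, 0 <= u n x) /\ (forall n, u n x <= u n.+1 x) /\
                      (u n x @[n --> \oo] --> f x)} ->
    (exists C : R, forall n, (N (u n) <= C%:E)%E) ->
    mem_sp N f /\ (forall n, (N (u n) <= N (u n.+1))%E) /\
    (N (u n) @[n --> \oo] --> N f).

Definition calderon d (T : measurableType d) (mu : {measure set T -> \bar R})
  (N0 N1 : (T -> R) -> \bar R) (theta : R) (f : T -> R) : \bar R :=
  ereal_inf [set l%:E | l in [set l : R | 0 < l /\
     exists f0 f1 : T -> R,
       [/\ measurable_fun setT f0, (N0 f0 <= 1)%E,
           measurable_fun setT f1, (N1 f1 <= 1)%E &
           {ae mu, forall x, `|f x| <= l * (`|f0 x| `^ (1 - theta) * `|f1 x| `^ theta)}]]].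

Definition sum_sp d (T : measurableType d) (N0 N1 : (T -> R) -> \bar R)
  (f : T -> R) := exists f0 f1, [/\ mem_sp N0 f0, mem_sp N1 f1 &
                                 f = (fun x => f0 x + f1 x)].

Definition couple_operator d (S : measurableType d) d' (S' : measurableType d')
  (mu : {measure set S -> \bar R}) (nu : {measure set S' -> \bar R})
  (X0 X1 : (S -> R) -> \bar R) (Y0 Y1 : (S' -> R) -> \bar R)
  (T : (S -> R) -> (S' -> R)) : Prop :=
  [/\ (forall f, sum_sp X0 X1 f -> sum_sp Y0 Y1 (T f)),
      (forall f g, sum_sp X0 X1 f -> sum_sp X0 X1 g -> aeeq mu f g ->
         aeeq nu (T f) (T g)),
      (forall (a b : R) f g, sum_sp X0 X1 f -> sum_sp X0 X1 g ->
         aeeq nu (T (fun x => a * f x + b * g x)) (fun y => a * T f y + b * T g y)),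
      (exists C : R, forall f, mem_sp X0 f ->
         mem_sp Y0 (T f) /\ (Y0 (T f) <= C%:E * X0 f)%E) &
      (exists C : R, forall f, mem_sp X1 f ->
         mem_sp Y1 (T f) /\ (Y1 (T f) <= C%:E * X1 f)%E)].

Definition positive_op d (S : measurableType d) d' (S' : measurableType d')
  (mu : {measure set S -> \bar R}) (nu : {measure set S' -> \bar R})
  (X0 X1 : (S -> R) -> \bar R) (T : (S -> R) -> (S' -> R)) : Prop :=
  forall f, sum_sp X0 X1 f -> ae_nonneg mu f -> ae_nonneg nu (T f).

Definition order_iso d (S : measurableType d) d' (S' : measurableType d')
  (mu : {measure set S -> \bar R}) (nu : {measure set S' -> \bar R})
  (NX : (S -> R) -> \bar R) (NY : (S' -> R) -> \bar R)
  (T : (S -> R) -> (S' -> R)) : Prop :=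
  [/\ (forall f, mem_sp NX f -> mem_sp NY (T f)) /\
      (forall (a b : R) f g, mem_sp NX f -> mem_sp NX g ->
         aeeq nu (T (fun x => a * f x + b * g x)) (fun y => a * T f y + b * T g y)),
      (forall f g, mem_sp NX f -> mem_sp NX g -> aeeq nu (T f) (T g) -> aeeq mu f g),
      (forall h, mem_sp NY h -> exists f, mem_sp NX f /\ aeeq nu (T f) h),
      (forall f, mem_sp NX f -> ae_nonneg mu f -> ae_nonneg nu (T f)) &
      (forall f, mem_sp NX f -> ae_nonneg nu (T f) -> ae_nonneg mu f)].

End Defs.

(* Main.v *)
(* By the symmetry theta <-> 1 - theta we may assume theta0 < theta1; put
   s = theta0 / theta1.  Let f >= 0 be in X0 + X1 with T f in Y_theta1.  For a
   in the unit ball of X0, positivity gives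
     T (a^(1-s) f^s) <= (T a)^(1-s) (T f)^s,
   which lies in Y_theta0.  The inverse of T on Y_theta0 is positive, hence
   bounded, so a^(1-s) f^s <= K b^(1-theta0) c^theta0 with b, c in the unit
   balls of X0, X1.  Iterating with a replaced by b, multiplying the resulting
   inequalities and applying the AM-GM inequality cancels a and leaves
   f <= K' B^(1-theta1) C^theta1, where B and C are Cesaro means, hence in the
   unit balls.  This holds only eventually, pointwise; a single pair (B, C)
   comes from the closedness of Calderon products under such limits.
   The latter is a Komlos-type argument: midpoints of the pairs which nearly
   minimise the convex functional int (1 / (1 + b) + 1 / (1 + c)) converge
   almost everywhere, and the Fatou property puts the limits in the unit balls.

   Surjectivity at theta1 follows by truncating h in Y_theta1 to elements of
   Y_theta0, inverting there, and passing to the supremum; T commutes with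
   this supremum because its order continuity on X_theta0 is inherited by
   X_theta1.  Positivity of the inverse follows in the same way from the fact
   that T preserves disjointness on X_theta0. *)

Require Import Defs.
From HB Require Import structures.
From mathcomp Require Import all_boot all_order all_algebra.
From mathcomp Require Import all_classical all_reals all_analysis.
From mathcomp Require Import measurable_realfun ring lra.
Set Implicit Arguments.
Unset Strict Implicit.
Unset Printing Implicit Defensive.
Import Order.TTheory GRing.Theory Num.Theory numFieldNormedType.Exports.
Local Open Scope classical_set_scope.
Local Open Scope ring_scope.

(** * Weighted geometric means *)

Section geometric_mean.
Context {R : realType}.
Implicit Types (t u v r : R).

Definition gm t u v : R := u `^ (1 - t) * v `^ t.

Lemma gm_ge0 t u v : 0 <= gm t u v.
Proof. by rewrite mulr_ge0 ?powR_ge0. Qed.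

Lemma gm_gt0 t u v : 0 < u -> 0 < v -> 0 < gm t u v.
Proof. by move=> u0 v0; rewrite mulr_gt0 ?powR_gt0. Qed.

Lemma gm_sym t u v : gm (1 - t) u v = gm t v u.
Proof. by rewrite /gm opprB addrCA subrr addr0 mulrC. Qed.

Lemma gmZ t k u v : 0 < t < 1 -> 0 <= k -> 0 <= u -> 0 <= v ->
  gm t (k * u) (k * v) = k * gm t u v.
Proof.
move=> /andP[t0 t1] k0 u0 v0; rewrite /gm !powRM// mulrACA -powRD; last first.
  by rewrite subrK oner_eq0.
by rewrite subrK powRr1.
Qed.

Lemma le_gm t u u' v v' : 0 < t < 1 -> 0 <= u -> u <= u' -> 0 <= v -> v <= v' ->
  gm t u v <= gm t u' v'.
Proof.
move=> /andP[t0 t1] u0 uu v0 vv; apply: ler_pM; rewrite ?powR_ge0//.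
  by apply: ge0_ler_powR; rewrite ?nnegrE ?subr_ge0 ?(ltW t1)//; exact: le_trans uu.
by apply: ge0_ler_powR; rewrite ?nnegrE ?(ltW t0)//; exact: le_trans vv.
Qed.

(** Weighted AM-GM: Young's inequality for the conjugate exponents [(1 - t)^-1] and [t^-1]. *)
Lemma gm_young t u v : 0 < t < 1 -> 0 <= u -> 0 <= v ->
  gm t u v <= (1 - t) * u + t * v.
Proof.
move=> /andP[t0 t1] u0 v0.
have s0 : 0 < 1 - t by rewrite subr_gt0.
have := @conjugate_powR _ (u `^ (1 - t)) (v `^ t) (1 - t)^-1 t^-1.
rewrite !powR_ge0 !invr_gt0 !invrK subrK => /(_ isT isT s0 t0 erefl).
by rewrite -!powRrM !mulfV ?gt_eqF// !powRr1// [u * _]mulrC [v * _]mulrC.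
Qed.

(** Both terms are compared with [gm t (u + u') (v + v')] by homogeneity and Young's inequality; the
    resulting two factors add up to 1. *)
Lemma gm_superadd t u u' v v' : 0 < t < 1 ->
  0 <= u -> 0 <= u' -> 0 <= v -> 0 <= v' ->
  gm t u v + gm t u' v' <= gm t (u + u') (v + v').
Proof.
move=> t01 u0 u'0 v0 v'0; have /andP[t0 t1] := t01.
have [U0|U0] := eqVneq (u + u') 0.
  move: U0; move/eqP; rewrite paddr_eq0// => /andP[/eqP-> /eqP->].
  by rewrite addr0 /gm powR0 ?subr_eq0 ?gt_eqF// !mul0r addr0.
have [V0|V0] := eqVneq (v + v') 0.
  move: V0; move/eqP; rewrite paddr_eq0// => /andP[/eqP-> /eqP->].
  by rewrite addr0 /gm powR0 ?gt_eqF// !mulr0 addr0.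
have Up : 0 < u + u' by rewrite lt_def U0 addr_ge0.
have Vp : 0 < v + v' by rewrite lt_def V0 addr_ge0.
have K a b : 0 <= a -> 0 <= b ->
    gm t a b <= gm t (u + u') (v + v') * ((1 - t) * (a / (u + u')) + t * (b / (v + v'))).
  move=> a0 b0.
  have -> : gm t a b = gm t (u + u') (v + v') * gm t (a / (u + u')) (b / (v + v')).
    rewrite /gm mulrACA -!powRM ?divr_ge0 ?(ltW Up) ?(ltW Vp)//.
    by rewrite ![_ * (_ / _)]mulrC !divfK.
  by rewrite ler_pM2l ?gm_gt0// gm_young// divr_ge0// ltW.
apply: le_trans (lerD (K _ _ u0 v0) (K _ _ u'0 v'0)) _.
rewrite -mulrDr ler_piMr ?gm_ge0// le_eqVlt; apply/orP; left; apply/eqP.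
by field; rewrite U0 V0.
Qed.

Lemma gm_lim0 t v r : 0 < t < 1 -> 0 <= v ->
  (forall e, 0 < e -> r <= gm t e (v + e)) -> r <= 0.
Proof.
move=> /andP[t0 t1] v0 H; have s0 : 0 < 1 - t by rewrite subr_gt0.
apply/ler_addgt0Pr => e e0; rewrite add0r.
pose C := (v + 1) `^ t.
have C0 : 0 < C by rewrite powR_gt0// ltr_wpDl.
(* [d <= 1] keeps the second factor below [C], and [d^(1 - t) <= e / C] makes the product at most
   [e]. *)
pose d := Num.min 1 ((e / C) `^ (1 - t)^-1).
have d0 : 0 < d by rewrite lt_min ltr01 powR_gt0// divr_gt0.
apply: le_trans (H d d0) _; rewrite -[leRHS](@divfK _ C) ?gt_eqF//.
apply: ler_pM; rewrite ?powR_ge0//.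
  have sn : 1 - t != 0 by rewrite gt_eqF.
  have -> : e / C = ((e / C) `^ (1 - t)^-1) `^ (1 - t).
    by rewrite -powRrM mulVf// powRr1// divr_ge0// ltW.
  apply: ge0_ler_powR; rewrite ?nnegrE ?powR_ge0 ?(ltW d0) ?(ltW s0)//.
  by rewrite ge_min lexx orbT.
apply: ge0_ler_powR; rewrite ?nnegrE ?(ltW t0) ?addr_ge0 ?(ltW d0)//.
by rewrite lerD2l ge_min lexx.
Qed.

(** For positive coordinates, the shift by [d * Num.min u v] is dominated by the dilation by
    [1 + d], and homogeneity finishes; a zero coordinate is the case of [gm_lim0]. *)
Lemma le_gm_lim t u v r : 0 < t < 1 -> 0 <= u -> 0 <= v ->
  (forall e, 0 < e -> r <= gm t (u + e) (v + e)) -> r <= gm t u v.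
Proof.
move=> t01 u0 v0 H; have /andP[t0 t1] := t01.
move: u0; rewrite le_eqVlt => /predU1P[u0|u0].
  rewrite -u0 /gm powR0 ?subr_eq0 ?gt_eqF// mul0r.
  by apply: (@gm_lim0 t v) => // e e0; have := H e e0; rewrite -u0 add0r.
move: v0; rewrite le_eqVlt => /predU1P[v0|v0].
  rewrite -v0 /gm powR0 ?gt_eqF// mulr0.
  apply: (@gm_lim0 (1 - t) u); rewrite ?(ltW u0)//; first by lra.
  by move=> e e0; have := H e e0; rewrite -v0 add0r gm_sym.
apply/ler_addgt0Pr => e e0.
have G0 := gm_gt0 t u0 v0.
pose d := e / gm t u v.
have d0 : 0 < d by rewrite divr_gt0.
pose m := Num.min u v; have m0 : 0 < m by rewrite lt_min u0.
have dm0 : 0 < d * m by rewrite mulr_gt0.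
apply: le_trans (H _ dm0) _.
apply: (@le_trans _ _ (gm t ((1 + d) * u) ((1 + d) * v))); last first.
  rewrite gmZ ?addr_ge0 ?(ltW d0) ?(ltW u0) ?(ltW v0)//.
  by rewrite mulrDl mul1r divfK// gt_eqF.
apply: le_gm => //; rewrite ?addr_ge0 ?(ltW u0) ?(ltW v0) ?(ltW dm0)//;
  by rewrite mulrDl mul1r lerD2l ler_pM2l// ge_min lexx ?orbT.
Qed.

(** The right side is a tangent plane of the concave function [gm t], touching along [v = q * u]. It
    comes from Young's inequality for [q^t * u] and [q^(t - 1) * v], where the powers of [q]
    cancel. *)
Lemma gm_tangent t q u v : 0 < t < 1 -> 0 < q -> 0 <= u -> 0 <= v ->
  gm t u v <= (1 - t) * q `^ t * u + t * q `^ (t - 1) * v.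
Proof.
move=> t01 q0 u0 v0.
have := @gm_young t (q `^ t * u) (q `^ (t - 1) * v) t01.
rewrite !mulr_ge0 ?powR_ge0// => /(_ isT isT); rewrite !mulrA; apply: le_trans.
rewrite /gm !powRM ?powR_ge0// mulrACA -!powRrM -powRD; last first.
  by rewrite (gt_eqF q0) implybT.
by rewrite (_ : t * (1 - t) + _ = 0) ?powRr0 ?mul1r//; ring.
Qed.

(** [gm t] is the infimum of its tangent planes. Rational slopes suffice by density, and a countable
    family can be handled almost everywhere in [T_gm]. *)
Lemma le_gm_tangents t u v r : 0 < t < 1 -> 0 <= u -> 0 <= v ->
  (forall q : rat, 0 < (ratr q : R) ->
    r <= (1 - t) * (ratr q) `^ t * u + t * (ratr q) `^ (t - 1) * v) ->
  r <= gm t u v.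
Proof.
move=> t01 u0 v0 H; have /andP[t0 t1] := t01.
have s0 : 0 < 1 - t by rewrite subr_gt0.
(* A shift by [e] makes both coordinates positive, so that an optimal slope [y / x] exists. *)
suff K x y : 0 < x -> 0 < y -> (forall q : rat, 0 < (ratr q : R) ->
    r <= (1 - t) * (ratr q) `^ t * x + t * (ratr q) `^ (t - 1) * y) ->
  r <= gm t x y.
  apply: le_gm_lim => // e e0; apply: K; rewrite ?ltr_wpDl// => q q0.
  apply: le_trans (H q q0) _; apply: lerD; apply: ler_wpM2l;
    by rewrite ?mulr_ge0 ?powR_ge0 ?lerDl ?ltW.
move=> x0 y0 {}H; apply/ler_addgt0Pr => e e0.
have G0 := gm_gt0 t x0 y0.
pose d := e / gm t x y; have d0 : 0 < d by rewrite divr_gt0.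
have yx0 : 0 < y / x by rewrite divr_gt0.
(* Compared with the optimal slope [y / x], a slope in this interval enlarges the first term by at
   most the factor [1 + d] and does not enlarge the second; [d * gm t x y = e]. *)
have [q] : exists q : rat, ratr q \in `]y / x, (1 + d) * (y / x)[%R.
  by apply: rat_in_itvoo; rewrite mulrDl mul1r ltrDl mulr_gt0.
rewrite in_itv/= => /andP[q1 q2].
have q0 : 0 < (ratr q : R) by exact: lt_trans q1.
apply: le_trans (H q q0) _.
have E1 : (y / x) `^ t * x = gm t x y.
  rewrite powRM ?invr_ge0 ?ltW// -{2}(powRr1 (ltW x0)) -powR_inv1 ?ltW// -powRrM.
  by rewrite -mulrA -powRD ?(gt_eqF x0) ?implybT// /gm mulrC mulN1r addrC.
have E2 : (y / x) `^ (t - 1) * y = gm t x y.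
  rewrite powRM ?invr_ge0 ?ltW// -{2}(powRr1 (ltW y0)) -powR_inv1 ?ltW// -powRrM.
  rewrite mulrAC -powRD ?(gt_eqF y0) ?implybT// /gm mulrC mulN1r subrK.
  by rewrite opprB.
have -> : gm t x y + e = (1 - t) * ((1 + d) * gm t x y) + t * gm t x y + t * e.
  by rewrite /d; field; rewrite gt_eqF.
rewrite -[leLHS]addr0; apply: lerD; last by rewrite mulr_ge0 ?ltW.
rewrite -!mulrA; apply: lerD; apply: ler_wpM2l; rewrite ?(ltW s0) ?(ltW t0)//.
  rewrite -E1 mulrA ler_pM2r//.
  have d1 : 1 <= 1 + d by rewrite lerDl ltW.
  apply: (@le_trans _ _ (((1 + d) * (y / x)) `^ t)).
    by apply: ge0_ler_powR; rewrite ?nnegrE ?(ltW t0) ?ltW// mulr_gt0// ltr_wpDr// ltW.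
  rewrite powRM ?(ltW yx0) ?(le_trans ler01 d1)//.
  by rewrite ler_wpM2r ?powR_ge0// ler1_powR// ltW.
rewrite -E2 ler_pM2r// -(opprB 1 t) !powRN lef_pV2 ?posrE ?powR_gt0//.
by apply: ge0_ler_powR; rewrite ?nnegrE ?ltW.
Qed.

(** Since [1 - s * t = (1 - s) + (1 - t) * s], the powers of [x] and [u] merge into one power of the
    common majorant [x + u]. *)
Lemma gm_gm s t x u v : 0 < t < 1 -> 0 < s < 1 -> 0 <= x -> 0 <= u -> 0 <= v ->
  gm s x (gm t u v) <= gm (s * t) (x + u) v.
Proof.
move=> /andP[t0 t1] /andP[s0 s1] x0 u0 v0.
have xu0 : 0 <= x + u by rewrite addr_ge0.
rewrite /gm powRM ?powR_ge0// -!powRrM [t * s]mulrC mulrA ler_wpM2r ?powR_ge0//.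
have -> : 1 - s * t = (1 - s) + (1 - t) * s by ring.
have [z|z] := eqVneq (x + u) 0.
  move: z; move/eqP; rewrite paddr_eq0// => /andP[/eqP-> /eqP->].
  by rewrite powR0 ?subr_eq0 ?gt_eqF// mul0r powR_ge0.
rewrite (@powRD _ _ (1 - s)) ?z ?implybT//; apply: ler_pM; rewrite ?powR_ge0//;
  by apply: ge0_ler_powR; rewrite ?nnegrE ?mulr_ge0 ?subr_ge0 ?lerDl ?lerDr// ltW.
Qed.

(** [gm t u v] is itself a mean [gm k (gm s u v) v] with [k = (t - s) / (1 - s)]; Young's inequality
    for rescaled factors makes the coefficient of [v] as small as desired. *)
Lemma gm_split s t e : 0 < s -> s < t -> t < 1 -> 0 < e ->
  exists2 l, 0 < l & forall u v, 0 <= u -> 0 <= v ->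
    gm t u v <= l * gm s u v + e * v.
Proof.
move=> s0 st t1 e0.
have s1 : 0 < 1 - s by rewrite subr_gt0 (lt_trans st).
have r0 : 0 < 1 - t by rewrite subr_gt0.
pose k := (t - s) / (1 - s).
have k0 : 0 < k by rewrite divr_gt0// subr_gt0.
have k1 : k < 1 by rewrite ltr_pdivrMr// mul1r ltrD2r.
have kk : 1 - k = (1 - t) / (1 - s) by rewrite /k; field; rewrite gt_eqF.
have k1' : 1 - k != 0 by rewrite subr_eq0 gt_eqF.
(* This power of [e] compensates the factor [e^k] that [e * v] contributes to the mean. *)
exists (e `^ (- (k / (1 - k)))); first exact: powR_gt0.
move=> u v u0 v0.
have := @gm_young k (e `^ (- (k / (1 - k))) * gm s u v) (e * v).
rewrite k0 k1 !mulr_ge0 ?powR_ge0 ?gm_ge0 ?(ltW e0)// => /(_ isT isT isT) H.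
suff -> : gm t u v = gm k (e `^ (- (k / (1 - k))) * gm s u v) (e * v).
  apply: le_trans H _; apply: lerD; apply: ler_piMl;
  by rewrite ?mulr_ge0 ?powR_ge0 ?gm_ge0 ?(ltW e0)//; lra.
rewrite /gm !powRM ?powR_ge0 ?mulr_ge0 ?powR_ge0 ?(ltW e0)// -!powRrM.
rewrite mulNr divfK// powRN mulrACA mulVf ?mul1r; last by rewrite gt_eqF ?powR_gt0.
rewrite [LHS](_ : _ = u `^ ((1 - s) * (1 - k)) * (v `^ (s * (1 - k)) * v `^ k)); last first.
  rewrite -powRD; last by rewrite gt_eqF// addr_gt0// mulr_gt0// subr_gt0.
  by congr (_ `^ _ * _ `^ _); rewrite /k; field; rewrite gt_eqF.
by rewrite !mulrA.
Qed.
End geometric_mean.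

(** * Function norms with the Fatou property *)

Section function_norm.
Context {R : realType} d (T : measurableType d) (mu : {measure set T -> \bar R}).
Variable N : (T -> R) -> \bar R.
Implicit Types f g : T -> R.

(** Nonnegativity is required everywhere, so that estimates on [gm] apply at each point without an
    exceptional set. *)
Definition unit_ball_nonneg (f : T -> R) :=
  [/\ measurable_fun setT f, (forall x, 0 <= f x) & (N f <= 1)%E].

Hypothesis bl : banach_lattice mu N.

Lemma norm_ge0 f : measurable_fun setT f -> (0 <= N f)%E.
Proof. by case: bl => -[+ _] *; exact. Qed.

Lemma normZ (c : R) f : measurable_fun setT f ->
  N (fun x => c * f x) = (`|c|%:E * N f)%E.
Proof. by case: bl => -[_ [_ +]] _ _ _ _ mf; apply. Qed.

Lemma normD f g : measurable_fun setT f -> measurable_fun setT g ->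
  (N (fun x => f x + g x)%R <= N f + N g)%E.
Proof. by case: bl => _ + _ _ _; exact. Qed.

Lemma le_norm_ae f g : measurable_fun setT f -> measurable_fun setT g ->
  {ae mu, forall x, `|f x| <= `|g x|} -> (N f <= N g)%E.
Proof. by case: bl => _ _ + _ _; exact. Qed.

Lemma le_norm f g : measurable_fun setT f -> measurable_fun setT g ->
  (forall x, `|f x| <= `|g x|) -> (N f <= N g)%E.
Proof. by move=> mf mg fg; apply: le_norm_ae => //; exact: aeW. Qed.

Lemma norm_normr f : measurable_fun setT f -> N (fun x => `|f x|) = N f.
Proof.
move=> mf; have mf' : measurable_fun setT (fun x => `|f x|).
  exact: measurableT_comp.
by apply/eqP; rewrite eq_le !le_norm// => x; rewrite normr_id.
Qed.

Lemma norm_eq0 f : measurable_fun setT f -> N f = 0%E -> aeeq mu f (fun=> 0).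
Proof. by move=> mf; case: bl => -[_ [+ _]] _ _ _ _ => /(_ f mf)[]. Qed.

Lemma mem_spP f : mem_sp N f ->
  exists2 C : R, 0 < C & (N f <= C%:E)%E.
Proof.
move=> [mf]; have := norm_ge0 mf; case: (N f) => // r.
rewrite lee_fin => r0 _; exists (r + 1); first by rewrite ltr_wpDl.
by rewrite lee_fin lerDl.
Qed.

Lemma unit_ball_nonneg_mem_sp f : unit_ball_nonneg f -> mem_sp N f.
Proof. by move=> [mf _ /le_lt_trans fN]; split=> //; apply: fN; rewrite ltry. Qed.

Lemma unit_ball_nonnegZ f (C : R) : measurable_fun setT f -> 0 < C ->
  (N f <= C%:E)%E -> unit_ball_nonneg (fun x => `|f x| / C).
Proof.
move=> mf C0 fC; have mf' : measurable_fun setT (fun x => `|f x|).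
  exact: measurableT_comp.
split=> [||].
- exact: measurable_funM.
- by move=> x; rewrite divr_ge0// ltW.
- rewrite (_ : (fun x => _) = (fun x => C^-1 * `|f x|)); last first.
    by apply/funext => x; rewrite mulrC.
  rewrite normZ// norm_normr// gtr0_norm ?invr_gt0//.
  apply: le_trans (lee_wpmul2l _ fC) _; first by rewrite lee_fin invr_ge0 ltW.
  by rewrite -EFinM mulVf// gt_eqF.
Qed.

Lemma mem_spZ (c : R) f : mem_sp N f -> mem_sp N (fun x => c * f x).
Proof.
move=> [mf fy]; split; first exact: measurable_funM.
by rewrite normZ// lte_mul_pinfty// lee_fin.
Qed.

Lemma mem_spD f g : mem_sp N f -> mem_sp N g -> mem_sp N (fun x => f x + g x).
Proof.
move=> [mf fy] [mg gy]; split; first exact: measurable_funD.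
by apply: le_lt_trans (normD mf mg) _; exact: lte_add_pinfty.
Qed.

Lemma mem_sp_le f g : measurable_fun setT f -> mem_sp N g ->
  {ae mu, forall x, `|f x| <= `|g x|} -> mem_sp N f.
Proof.
by move=> mf [mg gy] fg; split=> //; apply: le_lt_trans gy; exact: le_norm_ae.
Qed.

Lemma mem_sp_normr f : mem_sp N f -> mem_sp N (fun x => `|f x|).
Proof. by move=> [mf fy]; split; [exact: measurableT_comp|rewrite norm_normr]. Qed.

Lemma unit_ball_nonneg_pos :
  exists2 f, unit_ball_nonneg f & {ae mu, forall x, 0 < f x}.
Proof.
case: bl => _ _ _ [w [wN w0]] _; have [C C0 wC] := mem_spP wN.
exists (fun x => `|w x| / C); first by apply: unit_ball_nonnegZ => //; case: wN.
by apply: filterS w0 => x w0; rewrite divr_gt0// normr_gt0 gt_eqF.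
Qed.

Lemma norm_sum_le (f : nat -> T -> R) (c : nat -> R) n :
  (forall k, unit_ball_nonneg (f k)) -> (forall k, 0 <= c k) ->
  measurable_fun setT (fun x => \sum_(i < n) c i * f i x) /\
  (N (fun x => \sum_(i < n) c i * f i x)%R <= (\sum_(i < n) c i)%:E)%E.
Proof.
move=> bf c0; elim: n => [|n [mS IH]].
  have E : (fun x => \sum_(i < 0) c i * f i x) = (fun x => 0 * f 0%N x).
    by apply/funext => x; rewrite big_ord0 mul0r.
  have mf : measurable_fun setT (f 0%N) by case: (bf 0%N).
  rewrite E big_ord0 normZ// normr0 mul0e; split => //.
  exact: measurable_funM.
have E : (fun x => \sum_(i < n.+1) c i * f i x) =
         (fun x => (\sum_(i < n) c i * f i x) + c n * f n x).
  by apply/funext => x; rewrite big_ord_recr.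
have [mf _ fN] := bf n.
have mcf : measurable_fun setT (fun x => c n * f n x) by exact: measurable_funM.
rewrite E big_ord_recr/=; split; first exact: measurable_funD.
apply: le_trans (normD mS mcf) _; rewrite EFinD; apply: leeD => //.
rewrite normZ// ger0_norm// -[leRHS]mule1; apply: lee_wpmul2l => //.
by rewrite lee_fin.
Qed.

Lemma unit_ball_nonneg_mean (f : nat -> T -> R) n :
  (forall k, unit_ball_nonneg (f k)) ->
  unit_ball_nonneg (fun x => (\sum_(i < n.+1) f i x) / n.+1%:R).
Proof.
move=> bf; have [] := @norm_sum_le f (fun=> n.+1%:R^-1) n.+1 bf.
  by move=> _; rewrite invr_ge0.
have -> : (fun x => \sum_(i < n.+1) n.+1%:R^-1 * f i x) =
    (fun x => (\sum_(i < n.+1) f i x) / n.+1%:R).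
  by apply/funext => x; rewrite -mulr_sumr mulrC.
move=> mS SN; split => //.
  by move=> x; rewrite divr_ge0// sumr_ge0// => i _; case: (bf i).
apply: le_trans SN _; rewrite sumr_const card_ord lee_fin.
by rewrite -[leLHS]mulr_natr mulVf.
Qed.

Lemma unit_ball_nonneg_midpoint f g : unit_ball_nonneg f -> unit_ball_nonneg g ->
  unit_ball_nonneg (fun x => (f x + g x) / 2).
Proof.
move=> bf bg; pose h n := if n is 0%N then f else g.
have -> : (fun x => (f x + g x) / 2) = (fun x => (\sum_(i < 2) h i x) / 2%:R).
  by apply/funext => x; rewrite !big_ord_recr big_ord0/= add0r.
by apply: unit_ball_nonneg_mean; case.
Qed.

(** * Limits in the unit ball under the Fatou property *)

Hypothesis fp : fatou_property mu N.

Lemma fatou_unit_ball (u : nat -> T -> R) f : measurable_fun setT f ->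
  (forall n, unit_ball_nonneg (u n)) -> (forall n x, u n x <= u n.+1 x) ->
  {ae mu, forall x, u n x @[n --> \oo] --> f x} -> (N f <= 1)%E.
Proof.
move=> mf bu uS uf.
have [|n|||_ [_ Nuf]] := @fp u f => //.
- exact/unit_ball_nonneg_mem_sp.
- by apply: filterS uf => x ufx; split => // n; case: (bu n).
- by exists 1 => n; case: (bu n).
- by apply: cvge_le Nuf; near=> n; case: (bu n).
Unshelve. all: by end_near. Qed.

(** The supremum could be infinite on a set [E]. There the truncations of [u n] at height [m]
    increase to [m], so by the Fatou property all multiples [m * \1_E] lie in the unit ball; hence
    [\1_E] has norm zero and [E] is null. *)
Lemma monotone_limit (u : nat -> T -> R) :
  (forall n, unit_ball_nonneg (u n)) -> (forall n x, u n x <= u n.+1 x) ->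
  exists2 f, unit_ball_nonneg f & {ae mu, forall x, u n x @[n --> \oo] --> f x}.
Proof.
move=> bu uS.
pose F x := ereal_sup (range (fun n => (u n x)%:E)).
have uh x : {homo (u ^~ x) : n m / (n <= m)%N >-> n <= m}.
  by apply/nondecreasing_seqP.
have uF x : (u n x)%:E @[n --> \oo] --> F x.
  by apply: ereal_nondecreasing_cvgn => n m nm; rewrite lee_fin uh.
have mF : measurable_fun setT F.
  apply: (emeasurable_fun_cvg (fun n x => (u n x)%:E)) => // n.
  by apply/measurable_EFinP; case: (bu n).
have F0 x : (0 <= F x)%E.
  apply: (@le_trans _ _ (u 0%N x)%:E); first by case: (bu 0%N) => _ + _; exact.
  by apply: ereal_sup_ubound; exists 0%N.
pose E := F @^-1` [set +oo%E].
have mE : measurable E.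
  by rewrite -[E]setTI; apply: mF => //; exact: emeasurable_set1.
have NE (m : nat) : (N (fun x => (m%:R * \1_E x)%R) <= 1)%E.
  apply: (@fatou_unit_ball (fun n x => Num.min (u n x) m%:R * \1_E x)).
  - exact: measurable_funM.
  - move=> n; have [mu_ u0 uN] := bu n.
    have mv : measurable_fun setT (fun x => Num.min (u n x) m%:R * (\1_E x : R)).
      by apply: measurable_funM => //; exact: measurable_minr.
    split => //; first by move=> x; rewrite mulr_ge0 ?indicE// le_min u0 ler0n.
    apply: le_trans uN; apply: le_norm => // x.
    rewrite !ger0_norm ?mulr_ge0 ?indicE ?le_min ?u0 ?ler0n//.
    case: (x \in E); rewrite ?mulr1 ?mulr0//.
    by rewrite ge_min lexx.
  - move=> n x; apply: ler_wpM2r; first by rewrite indicE.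
    by rewrite le_min !ge_min uS lexx/= orbT.
  - apply: aeW => x; rewrite indicE; case: (boolP (x \in E)); last first.
      move=> _; rewrite mulr0.
      rewrite (_ : (fun n => _) = (fun=> 0)); first exact: cvg_cst.
      by apply/funext => n; rewrite mulr0.
    rewrite inE /E/= => Fx; rewrite mulr1.
    apply: cvg_near_cst.
    have /cvgeyPge /(_ m%:R) : (u n x)%:E @[n --> \oo] --> +oo%E.
      by rewrite -Fx.
    apply: filterS => n; rewrite lee_fin mulr1 => mn.
    by rewrite min_r.
have E0 : {ae mu, forall x, ~ E x}.
  have mI : measurable_fun setT (\1_E : T -> R) by exact: measurable_indic.
  have : N \1_E = 0%E.
    have := norm_ge0 mI; have := NE 1%N.
    rewrite (_ : (fun x => _) = \1_E); last by apply/funext => x; rewrite mul1r.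
    case NI : (N \1_E) => [r| |]//; rewrite !lee_fin => r1 r0.
    congr EFin; apply/eqP; rewrite eq_le r0 andbT leNgt; apply/negP => rp.
    have := NE (Num.bound r^-1); rewrite normZ// NI -EFinM lee_fin leNgt => /negP; apply.
    have rV := archi_boundP (ltW (etrans (invr_gt0 r) rp)).
    by rewrite ger0_norm// -ltr_pdivrMr// div1r.
  move/(norm_eq0 mI); apply: filterS => x.
  by rewrite indicE => + Ex; rewrite mem_set// => /eqP; rewrite oner_eq0.
have mf : measurable_fun setT (fine \o F).
  by apply: measurableT_comp => //; exact: fine_measurable.
have uf : {ae mu, forall x, u n x @[n --> \oo] --> (fine \o F) x}.
  apply: filterS E0 => x Ex.
  have Fx : F x \is a fin_num by rewrite ge0_fin_numE// ltey; apply/eqP.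
  have := uF x; rewrite -(fineK Fx) => /fine_cvgP[_].
  exact.
exists (fine \o F) => //; split => //.
  by move=> x/=; exact: fine_ge0.
exact: (fatou_unit_ball _ _ _ uf).
Qed.

(** [f] is the sum of the series of [2^-(n+1) * p n]: its partial sums have norm at most [1 - 2^-n],
    and [monotone_limit] applies to them. *)
Lemma dominating_element (p : nat -> T -> R) :
  (forall n, unit_ball_nonneg (p n)) ->
  exists2 f, unit_ball_nonneg f &
    {ae mu, forall x n, p n x <= 2 ^+ n.+1 * f x}.
Proof.
move=> bp; pose c n : R := 2 ^- n.+1.
have c0 n : 0 < c n by rewrite invr_gt0 exprn_gt0.
pose u n x := \sum_(i < n) c i * p i x.
have cS n : \sum_(i < n) c i = 1 - 2 ^- n.
  elim: n => [|n IH]; first by rewrite big_ord0 expr0 invr1 subrr.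
  by rewrite big_ord_recr/= IH /c exprS; field; rewrite expf_neq0.
have bu n : unit_ball_nonneg (u n).
  have [mS SN] := @norm_sum_le p c n bp (fun k => ltW (c0 k)).
  split => //.
    by move=> x; apply: sumr_ge0 => i _; rewrite mulr_ge0 ?(ltW (c0 i))//; case: (bp i).
  apply: le_trans SN _; rewrite cS lee_fin gerBl.
  by rewrite invr_ge0 exprn_ge0.
have uS n x : u n x <= u n.+1 x.
  by rewrite /u big_ord_recr/= lerDl mulr_ge0 ?(ltW (c0 n))//; case: (bp n).
have [f bf uf] := monotone_limit bu uS; exists f => //.
apply: filterS uf => x ufx n.
have uh : {homo (u ^~ x) : n m / (n <= m)%N >-> n <= m}.
  by apply/nondecreasing_seqP.
rewrite -ler_pdivrMl ?exprn_gt0//.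
have := nondecreasing_cvgn_le uh (cvgP _ ufx) n.+1.
rewrite (cvg_lim _ ufx)//; apply: le_trans.
rewrite /u big_ord_recr/= lerDr; apply: sumr_ge0 => i _.
by rewrite mulr_ge0 ?(ltW (c0 i))//; case: (bp i).
Qed.

(* The reciprocals [1 / (1 + b n)] converging allows the limit of [b n] to be
   infinite; the Fatou property excludes this almost everywhere. *)
Lemma limit_of_reciprocals (b : nat -> T -> R) :
  (forall n, unit_ball_nonneg (b n)) ->
  {ae mu, forall x, cvgn (fun n => (1 + b n x)^-1)} ->
  exists2 f, unit_ball_nonneg f & {ae mu, forall x e, 0 < e ->
    \forall n \near \oo, b n x <= f x + e}.
Proof.
move=> bb cb; have b0 n x : 0 <= b n x by case: (bb n).
have lb x : has_lbound (range (b ^~ x)) by exists 0 => _ [n _ <-].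
have lbd x n : has_lbound (sdrop (b ^~ x) n) by exists 0 => _ [k _ <-].
(* The tail infima lie below [b n], hence in the unit ball, and increase to the lower limit of [b],
   which becomes [f]. *)
pose u n x := infs (b ^~ x) n.
have u0 n x : 0 <= u n x.
  by apply: lb_le_inf; [exists (b n x), n => /=|move=> _ [k _ <-]].
have mu_ n : measurable_fun setT (u n).
  by apply: measurable_fun_infs => // m; case: (bb m).
have bu n : unit_ball_nonneg (u n).
  split => //; have [mb _ bN] := bb n; apply: le_trans bN; apply: le_norm => // x.
  by rewrite !ger0_norm//; apply: ge_inf => //; exists n => /=.
have uS n x : u n x <= u n.+1 x by apply: nondecreasing_infs.
have [f bf uf] := monotone_limit bu uS; exists f => //.
apply: filterS2 cb uf => x /cvg_ex[l bl_] ufx e e0.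
have f0 : 0 <= f x by case: bf.
have uh : {homo (u ^~ x) : n m / (n <= m)%N >-> n <= m}.
  by apply/nondecreasing_seqP.
have uf_le n : u n x <= f x.
  by have := nondecreasing_cvgn_le uh (cvgP _ ufx) n; rewrite (cvg_lim _ ufx).
(* Either [l] is large enough to keep [b n] eventually below [f x + e], or [b n] eventually exceeds
   [f x + e / 2] and a tail infimum exceeds its limit [f x], which is absurd. *)
have [lt_l|ge_l] := ltP (1 + f x + e)^-1 l.
  have [k _ Hk] := cvgr_gt l bl_ _ lt_l; exists k => // n kn; have := Hk n kn.
  rewrite /= ltf_pV2 ?posrE; [|by rewrite ltr_wpDl ?addr_ge0|by rewrite ltr_wpDr].
  by rewrite -addrA ltrD2l => /ltW.
have lt_l : l < (1 + f x + e / 2)^-1.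
  apply: le_lt_trans ge_l _; rewrite ltf_pV2 ?posrE.
  - by rewrite ltrD2l ltr_pdivrMr// ltr_pMr// ltr1n.
  - by rewrite ltr_wpDl ?addr_ge0.
  - by rewrite ltr_wpDl ?addr_ge0// divr_gt0.
have [k _ Hk] := cvgr_lt l bl_ _ lt_l.
have := uf_le k; rewrite leNgt => /negP; case.
apply: (@lt_le_trans _ _ (f x + e / 2)); first by rewrite ltrDl divr_gt0.
apply: lb_le_inf; first by exists (b k x), k => /=.
move=> _ [n /= kn <-]; have := Hk n kn.
rewrite /= ltf_pV2 ?posrE; [|by rewrite ltr_wpDr|by rewrite ltr_wpDl ?addr_ge0// divr_gt0].
by rewrite -addrA ltrD2l => /ltW.
Qed.
End function_norm.

(** * Closedness of Calderon products *)

Section closedness.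
Context {R : realType} d (T : measurableType d) (mu : {measure set T -> \bar R}).
Implicit Types f g h : T -> R.

(** [P] is a weighted sum of restrictions of [mu] to sets of finite measure covering the space.
    Bounded measurable functions are integrable for [P], while almost everywhere statements transfer
    from it to [mu]. *)
Lemma dominated_by_finite_measure : sigma_finite setT mu ->
  exists2 P : {measure set T -> \bar R}, (P setT < +oo)%E &
    forall A, measurable A -> P A = 0%E -> mu A = 0%E.
Proof.
move=> [F FT /all_and2[mF Fy]].
(* The weights give the [i]-th piece mass at most [2^-(i+1)]; adding 1 avoids a division by zero. *)
pose c i : R := (1 + fine (mu (F i)))^-1 / (2 ^ i.+1)%:R.
have a0 i : 0 < 1 + fine (mu (F i)) by rewrite ltr_wpDr// fine_ge0.
have c0 i : 0 < c i by rewrite divr_gt0 ?invr_gt0// ltr0n expn_gt0.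
pose m i := mscale (NngNum (ltW (c0 i))) (mrestr mu (mF i)).
exists (mseries m 0).
  rewrite /mseries; apply: (@le_lt_trans _ _ 1%E); last exact: ltry.
  apply: le_trans (@epsilon_trick0 R 1 xpredT ler01).
  apply: lee_nneseries => [i _ _|i _]; first exact: measure_ge0.
  rewrite -[leLHS]/((c i)%:E * mu (setT `&` F i))%E setTI.
  rewrite -(@fineK _ (mu (F i))) ?ge0_fin_numE//.
  rewrite -EFinM lee_fin /c div1r mulrAC ler_piMl ?invr_ge0//.
  by rewrite ler_pdivrMl// mulr1 lerDr.
move=> A mA PA0.
have AF i : mu (A `&` F i) = 0%E.
  have : ((c i)%:E * mu (A `&` F i) <= mseries m 0 A)%E.
    have := @nneseries_lim_ge R (fun i => m i A) xpredT 0 i.+1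
      (fun j _ _ => measure_ge0 (m j) A).
    apply: le_trans; rewrite big_nat_recr//= leeDr// sume_ge0//.
  rewrite PA0 pmule_rle0 ?lte_fin// => A0.
  by apply/eqP; rewrite eq_le A0 measure_ge0.
apply/eqP; rewrite -measure_le0.
have : (mu A <= \sum_(0 <= i <oo) mu (A `&` F i))%E.
  apply: measure_sigma_subadditive => //; first by move=> i; exact: measurableI.
  by rewrite -setI_bigcupr -FT setIT.
by rewrite eseries0.
Qed.

(** The increments are at most [2^-k] times the square root of [M], so the telescoping series is
    dominated by a geometric one; [1 + M] serves as a bound for the root. *)
Lemma cvg_of_fast_increments (u : R^nat) (M : R) :
  (forall k, 4 ^+ k * (u k.+1 - u k) ^+ 2 <= M) -> cvgn u.
Proof.
move=> uM.
have M0 : 0 <= M.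
  by apply: le_trans (uM 0%N); rewrite mulr_ge0 ?sqr_ge0 ?exprn_ge0.
have inc k : `|u k.+1 - u k| <= geometric (1 + M) 2^-1 k.
  rewrite /= -ler_pdivrMr ?exprn_gt0 ?invr_gt0// -exprVn invrK.
  rewrite -[leLHS]ger0_norm ?mulr_ge0 ?exprn_ge0//.
  apply: (@le_trans _ _ (Num.sqrt M)).
    rewrite -sqrtr_sqr; apply: ler_wsqrtr; apply: le_trans (uM k).
    by rewrite exprMn real_normK ?num_real// mulrC -exprM mulnC exprM (_ : 2 ^+ 2 = 4)//; ring.
  rewrite -[leRHS]ger0_norm ?addr_ge0// -sqrtr_sqr ler_wsqrtr//.
  rewrite sqrrD expr1n mul1r; have := sqr_ge0 M; lra.
have : cvgn (series (telescope u)).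
  apply: normed_cvg; apply: (@series_le_cvg _ _ (geometric (1 + M) 2^-1)).
  - by move=> k; exact: normr_ge0.
  - by move=> k; exact: le_trans (inc k).
  - exact: inc.
  - by apply: is_cvg_geometric_series; rewrite gtr0_norm ?invr_gt0// invf_lt1 ?ltr1n.
move=> ct; have -> : u = (fun n => u 0%N + series (telescope u) n).
  by apply/funext => n; exact: eq_sum_telescope.
by apply: is_cvgD => //; exact: is_cvg_cst.
Qed.

(** Both components are averaged with the same weights, as the superadditivity of [gm] requires.
    Midpoints are enough for minimising a convex functional and keep the proofs to a plain
    induction. *)
Inductive midpoint_hull (b c : nat -> T -> R) (n : nat) :
    (T -> R) -> (T -> R) -> Prop :=
| MidpointBase m : (n <= m)%N -> midpoint_hull b c n (b m) (c m)
| MidpointStep f g f' g' :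
    midpoint_hull b c n f g -> midpoint_hull b c n f' g' ->
    midpoint_hull b c n (fun x => (f x + f' x) / 2) (fun x => (g x + g' x) / 2).

Lemma midpoint_hullS b c n m f g : (n <= m)%N ->
  midpoint_hull b c m f g -> midpoint_hull b c n f g.
Proof.
move=> nm; elim=> [k mk|f1 g1 f2 g2 _ IH1 _ IH2].
  by apply: MidpointBase; exact: leq_trans mk.
exact: MidpointStep.
Qed.

(** Convexity of [1 / (1 + u)] with an explicit gap: the difference of the two sides is a square
    times [u + v + 2 * u * v], divided by a positive quantity. *)
Lemma reciprocal_midpoint (u v : R) : 0 <= u -> 0 <= v ->
  (1 + (u + v) / 2)^-1 + 4^-1 * ((1 + v)^-1 - (1 + u)^-1) ^+ 2 <=
  2^-1 * (1 + u)^-1 + 2^-1 * (1 + v)^-1.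
Proof.
move=> u0 v0.
have p0 : 0 < 1 + u by rewrite ltr_wpDr.
have q0 : 0 < 1 + v by rewrite ltr_wpDr.
have s0 : 0 < 2 + u + v by lra.
rewrite -subr_ge0.
have -> : 2^-1 * (1 + u)^-1 + 2^-1 * (1 + v)^-1 -
   ((1 + (u + v) / 2)^-1 + 4^-1 * ((1 + v)^-1 - (1 + u)^-1) ^+ 2) =
  (u - v) ^+ 2 * (2 * (1 + u) * (1 + v) - (2 + u + v)) /
  (4 * (1 + u) ^+ 2 * (1 + v) ^+ 2 * (2 + u + v)).
  by field; repeat (apply/andP; split); apply/eqP => ?; lra.
apply: divr_ge0; last by rewrite !mulr_ge0 ?exprn_ge0 ?ltW.
apply: mulr_ge0; first exact: sqr_ge0.
have := mulr_ge0 u0 v0; nra.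
Qed.

(** * A convex functional and its near-minimisers *)

Section reciprocal_functional.
Variable P : {measure set T -> \bar R}.
Hypothesis Py : (P setT < +oo)%E.

(** [J] below is the functional to be minimised over midpoint hulls; [del] measures how strict its
    midpoint inequality is, in terms of reciprocals. *)
Let psi f g x : R := (1 + f x)^-1 + (1 + g x)^-1.
Let del f g f' g' x : R :=
  ((1 + f' x)^-1 - (1 + f x)^-1) ^+ 2 + ((1 + g' x)^-1 - (1 + g x)^-1) ^+ 2.
Let J f g : R := \int[P]_x psi f g x.

Definition nonneg_measurable f := measurable_fun setT f /\ forall x, 0 <= f x.

Let mrec f : nonneg_measurable f -> measurable_fun setT (fun x => (1 + f x)^-1).
Proof.
move=> [mf f0].
have -> : (fun x => (1 + f x)^-1) = (fun x => (1 + f x) `^ (-1)).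
  by apply/funext => x; rewrite powR_inv1// addr_ge0.
apply: (measurableT_comp (measurable_powR _)).
exact: measurable_funD.
Qed.

Let rec01 f : nonneg_measurable f -> forall x, 0 <= (1 + f x)^-1 <= 1.
Proof.
move=> [_ f0] x; rewrite invr_ge0 addr_ge0//= invf_le1 ?lerDl//.
by rewrite ltr_wpDr.
Qed.

Let integrable_bounded h : measurable_fun setT h -> (forall x, 0 <= h x <= 2) ->
  P.-integrable setT (EFin \o h).
Proof.
move=> mh h2; apply: measurable_bounded_integrable => //.
exists 2; split; first exact: num_real.
move=> M M2 x _ /=; have /andP[h0 hx] := h2 x.
by rewrite ger0_norm// (le_trans hx)// ltW.
Qed.

Let psi_integrable f g : nonneg_measurable f -> nonneg_measurable g ->
  P.-integrable setT (EFin \o psi f g).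
Proof.
move=> nf ng; apply: integrable_bounded => [|x].
  by apply: measurable_funD; exact: mrec.
by rewrite /psi; have := rec01 nf x; have := rec01 ng x; lra.
Qed.

Let mdel f g f' g' : nonneg_measurable f -> nonneg_measurable g ->
  nonneg_measurable f' -> nonneg_measurable g' ->
  measurable_fun setT (del f g f' g').
Proof.
move=> nf ng nf' ng'.
by apply: measurable_funD; apply: measurable_funX; apply: measurable_funB;
  exact: mrec.
Qed.

Let del_integrable f g f' g' : nonneg_measurable f -> nonneg_measurable g ->
  nonneg_measurable f' -> nonneg_measurable g' ->
  P.-integrable setT (EFin \o del f g f' g').
Proof.
move=> nf ng nf' ng'; apply: integrable_bounded => [|x]; first exact: mdel.
rewrite /del addr_ge0 ?sqr_ge0//=.
suff sq (a b : R) : 0 <= a <= 1 -> 0 <= b <= 1 -> (a - b) ^+ 2 <= 1.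
  by rewrite (_ : 2 = 1 + 1)// lerD// sq ?rec01.
by move=> a1 b1; nra.
Qed.

Let J_midpoint f g f' g' : nonneg_measurable f -> nonneg_measurable g ->
  nonneg_measurable f' -> nonneg_measurable g' ->
  J (fun x => (f x + f' x) / 2) (fun x => (g x + g' x) / 2) +
    4^-1 * (\int[P]_x del f g f' g' x) <= 2^-1 * J f g + 2^-1 * J f' g'.
Proof.
have nmid h h' : nonneg_measurable h -> nonneg_measurable h' ->
    nonneg_measurable (fun x => (h x + h' x) / 2).
  move=> [mh h0] [mh' h0']; split.
    by apply: measurable_funM => //; exact: measurable_funD.
  by move=> x; rewrite divr_ge0// addr_ge0.
move=> nf ng nf' ng'.
have ip := psi_integrable (nmid _ _ nf nf') (nmid _ _ ng ng').
have id := del_integrable nf ng nf' ng'.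
have i1 := psi_integrable nf ng; have i2 := psi_integrable nf' ng'.
have Z (k : R) h : P.-integrable setT (EFin \o h) ->
    P.-integrable setT (EFin \o (fun x => k * h x)).
  move=> ih; have -> : EFin \o (fun x => k * h x) = (fun x => k%:E * (EFin \o h) x)%E.
    by apply/funext => x; rewrite /= EFinM.
  exact: integrableZl.
rewrite /J -!RintegralZl// -!RintegralD//; try exact: Z.
apply: le_Rintegral => //.
- have := integrableD measurableT ip (Z 4^-1 _ id); exact.
- have := integrableD measurableT (Z 2^-1 _ i1) (Z 2^-1 _ i2); exact.
- move=> x _; have [_ f0] := nf; have [_ f0'] := nf'.
  have [_ g0] := ng; have [_ g0'] := ng'.
  have := reciprocal_midpoint (f0 x) (f0' x).
  have := reciprocal_midpoint (g0 x) (g0' x).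
  rewrite /psi /del; lra.
Qed.

(** The infima of [J] over the hulls of later and later tails increase and stay bounded.
    Near-minimisers taken far enough out have almost the same value as their midpoints, so by
    [J_midpoint] consecutive ones are close in [del]; summability of these gaps gives convergence
    almost everywhere. *)
Lemma convergent_midpoints (b c : nat -> T -> R) :
  (forall n, nonneg_measurable (b n)) -> (forall n, nonneg_measurable (c n)) ->
  exists B C : nat -> T -> R,
  [/\ (forall k, midpoint_hull b c k (B k) (C k)),
      {ae P, forall x, cvgn (fun k => (1 + B k x)^-1)} &
      {ae P, forall x, cvgn (fun k => (1 + C k x)^-1)}].
Proof.
move=> nb nc.
have nh n f g : midpoint_hull b c n f g -> nonneg_measurable f /\ nonneg_measurable g.
  elim=> [m _ //|f1 g1 f2 g2 _ [[mf1 f10] [mg1 g10]] _ [[mf2 f20] [mg2 g20]]].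
  split; split.
  - by apply: measurable_funM => //; exact: measurable_funD.
  - by move=> x; rewrite divr_ge0// addr_ge0.
  - by apply: measurable_funM => //; exact: measurable_funD.
  - by move=> x; rewrite divr_ge0// addr_ge0.
pose V n := [set J f.1 f.2 | f in [set f | midpoint_hull b c n f.1 f.2]].
have Vlb n : lbound (V n) 0.
  move=> _ [[f g] /= /nh[nf ng] <-]; apply: Rintegral_ge0 => x _.
  by rewrite /psi; have := rec01 nf x; have := rec01 ng x; lra.
have Vinf n : has_inf (V n).
  split; last by exists 0.
  by exists (J (b n) (c n)), (b n, c n) => //=; exact: MidpointBase.
have V_le n f g : midpoint_hull b c n f g -> inf (V n) <= J f g.
  by move=> h; apply: ge_inf; [exists 0|exists (f, g)].
have Jbound f g : nonneg_measurable f -> nonneg_measurable g ->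
    J f g <= \int[P]_x (2 : R).
  move=> nf ng; apply: le_Rintegral => //.
  - exact: psi_integrable.
  - by apply: (@integrable_bounded (fun=> 2)) => // x; rewrite lexx andbT.
  - by move=> x _; rewrite /psi; have := rec01 nf x; have := rec01 ng x; lra.
pose W := range (fun n => inf (V n)).
have Wsup : has_sup W.
  split; first by exists (inf (V 0%N)), 0%N.
  exists (\int[P]_x (2 : R)) => _ [n _ <-].
  apply: le_trans (Jbound _ _ (nb n) (nc n)).
  by apply: V_le; exact: MidpointBase.
have VS n m : (n <= m)%N -> inf (V n) <= inf (V m).
  move=> nm; apply: lb_le_inf; first by have [] := Vinf m.
  by move=> _ [[f g] /= h <-]; apply: V_le; exact: midpoint_hullS h.
(* The ratio [1 / 8] beats the weight [4 ^+ k] of [cvg_of_fast_increments] and leaves a summable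
   [2^-k]. *)
pose eps k : R := 8^-1 ^+ k.
have eps0 k : 0 < eps k by rewrite exprn_gt0// invr_gt0.
have /choice[m Hm] k : exists n, sup W - eps k < inf (V n).
  by have [_ [n _ <-] ?] := sup_adherent (eps0 k) Wsup; exists n.
(* Maxima make the tail index [nn] nondecreasing, with [nn k] at least [k] and [m k]. *)
pose nn k := (\max_(j < k.+1) maxn j (m j))%N.
have nnS k : (nn k <= nn k.+1)%N by rewrite /nn [leqRHS]big_ord_recr/= leq_maxl.
have nn_max k : (maxn k (m k) <= nn k)%N.
  by rewrite /nn big_ord_recr/= leq_maxr.
have nn_k k : (k <= nn k)%N by apply: leq_trans (nn_max k); exact: leq_maxl.
have nn_m k : (m k <= nn k)%N by apply: leq_trans (nn_max k); exact: leq_maxr.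
have /choice[BC HBC] k : exists fg : (T -> R) * (T -> R),
    midpoint_hull b c (nn k) fg.1 fg.2 /\ J fg.1 fg.2 < sup W + eps k.
  have [_ [fg h <-] Jfg] := inf_adherent (eps0 k) (Vinf (nn k)).
  exists fg; split => //; apply: lt_le_trans Jfg _; rewrite lerD2r.
  by apply: ub_le_sup; [case: Wsup|exists (nn k)].
pose B k := (BC k).1; pose C k := (BC k).2.
have nB k : nonneg_measurable (B k) by have [/nh[]] := HBC k.
have nC k : nonneg_measurable (C k) by have [/nh[]] := HBC k.
pose dl k := del (B k) (C k) (B k.+1) (C k.+1).
have dl0 k x : 0 <= dl k x by rewrite addr_ge0 ?sqr_ge0.
have mdl k : measurable_fun setT (dl k) by exact: mdel.
(* Both pairs lie in the hull of the tail [nn k], and so does their midpoint, whose value is at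
   least [sup W - eps k]; the values at the pairs themselves are below [sup W + eps k]. *)
have D_le k : \int[P]_x dl k x <= 8 * eps k.
  have h1 : midpoint_hull b c (nn k) (B k) (C k) by have [] := HBC k.
  have h2 : midpoint_hull b c (nn k) (B k.+1) (C k.+1).
    by have [h _] := HBC k.+1; exact: midpoint_hullS h.
  have j1 : J (B k) (C k) < sup W + eps k by have [] := HBC k.
  have j2 : J (B k.+1) (C k.+1) < sup W + eps k.+1 by have [] := HBC k.+1.
  have := V_le _ _ _ (MidpointStep h1 h2).
  have := J_midpoint (nB k) (nC k) (nB k.+1) (nC k.+1).
  have := lt_le_trans (Hm k) (VS _ _ (nn_m k)).
  have eS : eps k.+1 = 8^-1 * eps k by rewrite /eps exprS.
  rewrite -/(dl k) eS in j2 *; have := eps0 k.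
  set I1 := J (fun _ => _) _; set I2 := Rintegral _ _ (dl k); lra.
pose F x : \bar R := (\sum_(0 <= k <oo) (4 ^+ k * dl k x)%:E)%E.
have mt k : measurable_fun setT (fun x => (4 ^+ k * dl k x)%:E).
  by apply/measurable_EFinP; exact: measurable_funM.
have t0 k x : (0 <= (4 ^+ k * dl k x)%:E)%E by rewrite lee_fin mulr_ge0 ?exprn_ge0.
have F0 x : (0 <= F x)%E by apply: nneseries_ge0.
have IF : (\int[P]_x F x < +oo)%E.
  rewrite /F integral_nneseries//.
  (* By [D_le] the [k]-th term is at most [8 * 2^-k = 16 / 2^(k+1)]. *)
  apply: (@le_lt_trans _ _ 16%:E); last exact: ltry.
  apply: le_trans (@epsilon_trick0 R 16 xpredT _) => //.
  apply: lee_nneseries => [k _ _|k _]; first exact: integral_ge0.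
  have ik : P.-integrable setT (EFin \o dl k) by exact: del_integrable.
  have -> : (\int[P]_x (4 ^+ k * dl k x)%:E =
      (4 ^+ k)%:E * \int[P]_x (dl k x)%:E)%E.
    under eq_integral do rewrite EFinM.
    apply: ge0_integralZl_EFin => //.
    - by move=> x _; rewrite lee_fin.
    - exact/measurable_EFinP.
  rewrite -[X in (_ * X)%E]fineK; last exact: integrable_fin_num.
  rewrite -EFinM lee_fin; apply: le_trans (ler_wpM2l _ (D_le k)) _ => //.
  rewrite /eps natrX exprS exprVn.
  have -> : 8 ^+ k = 4 ^+ k * 2 ^+ k :> R by rewrite -exprMn; congr (_ ^+ _); ring.
  rewrite le_eqVlt; apply/orP; left; apply/eqP; field.
  by rewrite !expf_neq0.
have Ffin : {ae P, forall x, F x \is a fin_num}.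
  have : P.-integrable setT F.
    apply/integrableP; split.
      exact: ge0_emeasurable_sum.
    by under eq_integral do rewrite gee0_abs//.
  by move/(integrable_ae measurableT); apply: filterS => x; apply.
have bnd x : F x \is a fin_num -> forall k, 4 ^+ k * dl k x <= fine (F x).
  move=> Fx k; rewrite -lee_fin fineK//.
  have := @nneseries_lim_ge R (fun k => (4 ^+ k * dl k x)%:E) xpredT 0 k.+1
    (fun j _ _ => t0 j x).
  by apply: le_trans; rewrite big_nat_recr//= leeDr// sume_ge0.
exists B, C; split.
- by move=> k; have [h _] := HBC k; exact: midpoint_hullS h.
- apply: filterS Ffin => x /bnd Fx; apply: (@cvg_of_fast_increments _ (fine (F x))) => k.
  apply: le_trans (Fx k); apply: ler_wpM2l; first exact: exprn_ge0.
  by rewrite /dl /del lerDl sqr_ge0.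
- apply: filterS Ffin => x /bnd Fx; apply: (@cvg_of_fast_increments _ (fine (F x))) => k.
  apply: le_trans (Fx k); apply: ler_wpM2l; first exact: exprn_ge0.
  by rewrite /dl /del lerDr sqr_ge0.
Qed.
End reciprocal_functional.

(** The conclusion says that the lower limit of [g n] is at most [gm t B C], phrased with lower
    bounds [r] so that no limit has to exist. Such bounds survive midpoints by superadditivity and
    homogeneity of [gm]. They thus hold along the convergent midpoints, which are eventually
    dominated, up to any [e], by the functions from [limit_of_reciprocals]. *)
Lemma calderon_closed (N0 N1 : (T -> R) -> \bar R) t (b c g : nat -> T -> R) :
  sigma_finite setT mu ->
  banach_lattice mu N0 -> fatou_property mu N0 ->
  banach_lattice mu N1 -> fatou_property mu N1 -> 0 < t < 1 ->
  (forall n, unit_ball_nonneg N0 (b n)) -> (forall n, unit_ball_nonneg N1 (c n)) ->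
  (forall n, {ae mu, forall x, g n x <= gm t (b n x) (c n x)}) ->
  exists B C, [/\ unit_ball_nonneg N0 B, unit_ball_nonneg N1 C &
    {ae mu, forall x r, (\forall n \near \oo, r <= g n x) ->
       r <= gm t (B x) (C x)}].
Proof.
move=> /dominated_by_finite_measure[P Py Pmu] bl0 fp0 bl1 fp1 t01 bb bc gbc.
have aeP Q : {ae P, forall x, Q x} -> {ae mu, forall x, Q x}.
  by move=> [A [mA /Pmu A0 QA]]; exists A; split => //; exact: A0.
have [||B [C [h cB cC]]] := @convergent_midpoints P Py b c.
- by move=> n; have [] := bb n.
- by move=> n; have [] := bc n.
have ball k f g' : midpoint_hull b c k f g' ->
    [/\ unit_ball_nonneg N0 f, unit_ball_nonneg N1 g' &
    {ae mu, forall x r, (forall n, (k <= n)%N -> r <= g n x) ->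
       r <= gm t (f x) (g' x)}].
  elim=> [m km|f1 g1 f2 g2 _ [bf1 bg1 H1] _ [bf2 bg2 H2]].
    split=> //; apply: filterS (gbc m) => x gx r /(_ m km) rg.
    exact: le_trans gx.
  split; [exact: (unit_ball_nonneg_midpoint bl0)|exact: (unit_ball_nonneg_midpoint bl1)|].
  apply: filterS2 H1 H2 => x H1 H2 r Hr.
  have [_ f10 _] := bf1; have [_ f20 _] := bf2.
  have [_ g10 _] := bg1; have [_ g20 _] := bg2.
  have := gm_superadd t01 (f10 x) (f20 x) (g10 x) (g20 x).
  rewrite ![_ / 2]mulrC gmZ ?addr_ge0//.
  by have := H1 r Hr; have := H2 r Hr; lra.
have bB k : unit_ball_nonneg N0 (B k) by have [] := ball _ _ _ (h k).
have bC k : unit_ball_nonneg N1 (C k) by have [] := ball _ _ _ (h k).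
have [B' bB' BB'] := limit_of_reciprocals bl0 fp0 bB (aeP _ cB).
have [C' bC' CC'] := limit_of_reciprocals bl1 fp1 bC (aeP _ cC).
exists B', C'; split => //.
have HH : {ae mu, forall x k r, (forall n, (k <= n)%N -> r <= g n x) ->
    r <= gm t (B k x) (C k x)}.
  by apply: ae_foralln => k; have [] := ball _ _ _ (h k).
apply: filterS3 BB' CC' HH => x Bx Cx Hx r [k _ Hk].
have [_ B'0 _] := bB'; have [_ C'0 _] := bC'.
apply: le_gm_lim => // e e0.
have [k1 _ Hk1] := Bx e e0; have [k2 _ Hk2] := Cx e e0.
pose j := maxn k (maxn k1 k2).
have jk : (k <= j)%N by rewrite leq_maxl.
have jk1 : (k1 <= j)%N by rewrite /j !leq_max leqnn orbT.
have jk2 : (k2 <= j)%N by rewrite /j !leq_max leqnn !orbT.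
apply: (@le_trans _ _ (gm t (B j x) (C j x))).
  by apply: Hx => n jn; apply: Hk; exact: leq_trans jn.
have [_ Bj0 _] := bB j; have [_ Cj0 _] := bC j.
by apply: le_gm => //; [exact: Hk1|exact: Hk2].
Qed.
End closedness.

(** * Calderon products and sum spaces *)

Section calderon_space.
Context {R : realType} d (T : measurableType d) (mu : {measure set T -> \bar R}).
Variables N0 N1 : (T -> R) -> \bar R.
Hypotheses (bl0 : banach_lattice mu N0) (bl1 : banach_lattice mu N1).
Implicit Types (f g p q b c : T -> R) (t : R).

(** A bound on the Calderon norm kept together with a factorisation realising it, since the factors
    themselves are iterated and passed to the limit. *)
Definition calderon_le t f (K : R) := exists b c,
  [/\ unit_ball_nonneg N0 b, unit_ball_nonneg N1 c &
      {ae mu, forall x, `|f x| <= K * gm t (b x) (c x)}].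

Lemma measurable_gm t p q : measurable_fun setT p -> measurable_fun setT q ->
  measurable_fun setT (fun x => gm t (p x) (q x)).
Proof.
move=> mp mq; apply: measurable_funM;
  exact: (measurableT_comp (measurable_powR _)).
Qed.

Lemma mem_calderonP t f : mem_sp (calderon mu N0 N1 t) f <->
  measurable_fun setT f /\ exists2 K, 0 < K & calderon_le t f K.
Proof.
split=> [[mf /ereal_inf_lt[_ [l [l0 [f0 [f1 [mf0 f01 mf1 f11 H]]]] <-] _]]|].
  split=> //; exists l => //; exists (fun x => `|f0 x|), (fun x => `|f1 x|).
  split=> //; split=> //.
  - exact: measurableT_comp.
  - by rewrite (norm_normr bl0).
  - exact: measurableT_comp.
  - by rewrite (norm_normr bl1).
move=> [mf [K K0 [b [c [[mb b0 bN] [mc c0 cN] H]]]]]; split=> //.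
apply: (@le_lt_trans _ _ K%:E); last exact: ltry.
apply: ereal_inf_lbound; exists K => //; split=> //; exists b, c; split=> //.
by apply: filterS H => x; rewrite (ger0_norm (b0 x)) (ger0_norm (c0 x)).
Qed.

Lemma calderon_leW t f g K : calderon_le t f K ->
  {ae mu, forall x, `|g x| <= `|f x|} -> calderon_le t g K.
Proof.
move=> [b [c [bb bc H]]] gf; exists b, c; split=> //.
by apply: filterS2 H gf => x H gf; exact: le_trans H.
Qed.

Lemma calderon_le_gm t f p q (C : R) : 0 < t < 1 -> 0 < C ->
  measurable_fun setT p -> (forall x, 0 <= p x) -> (N0 p <= C%:E)%E ->
  measurable_fun setT q -> (forall x, 0 <= q x) -> (N1 q <= C%:E)%E ->
  {ae mu, forall x, `|f x| <= gm t (p x) (q x)} -> calderon_le t f C.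
Proof.
move=> t01 C0 mp p0 pC mq q0 qC H.
exists (fun x => `|p x| / C), (fun x => `|q x| / C); split.
- exact: (unit_ball_nonnegZ bl0).
- exact: (unit_ball_nonnegZ bl1).
apply: filterS H => x H; rewrite -gmZ ?divr_ge0 ?(ltW C0)//.
by rewrite ![C * _]mulrC !divfK ?gt_eqF// (ger0_norm (p0 x)) (ger0_norm (q0 x)).
Qed.

Lemma mem_calderon_gm t f p q : 0 < t < 1 -> measurable_fun setT f ->
  mem_sp N0 p -> (forall x, 0 <= p x) -> mem_sp N1 q -> (forall x, 0 <= q x) ->
  {ae mu, forall x, `|f x| <= gm t (p x) (q x)} ->
  mem_sp (calderon mu N0 N1 t) f.
Proof.
move=> t01 mf pN p0 qN q0 H; apply/mem_calderonP; split=> //.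
have [C C0 pC] := mem_spP bl0 pN; have [D D0 qD] := mem_spP bl1 qN.
exists (C + D); first exact: addr_gt0.
apply: (calderon_le_gm t01 _ _ p0 _ _ q0 _ H).
- exact: addr_gt0.
- by case: pN.
- by apply: le_trans pC _; rewrite lee_fin lerDl ltW.
- by case: qN.
- by apply: le_trans qD _; rewrite lee_fin lerDr ltW.
Qed.

Lemma mem_calderonE t f : 0 < t < 1 -> mem_sp (calderon mu N0 N1 t) f ->
  exists p q, [/\ mem_sp N0 p, (forall x, 0 <= p x), mem_sp N1 q,
    (forall x, 0 <= q x) & {ae mu, forall x, `|f x| <= gm t (p x) (q x)}].
Proof.
move=> t01 /mem_calderonP[mf [K K0 [b [c [bb bc H]]]]].
exists (fun x => K * b x), (fun x => K * c x); split.
- exact/(mem_spZ bl0)/unit_ball_nonneg_mem_sp.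
- by move=> x; rewrite mulr_ge0 ?(ltW K0)//; case: bb.
- exact/(mem_spZ bl1)/unit_ball_nonneg_mem_sp.
- by move=> x; rewrite mulr_ge0 ?(ltW K0)//; case: bc.
- apply: filterS H => x H; rewrite gmZ ?(ltW K0)//; first by case: bb.
  by case: bc.
Qed.

Lemma mem_calderon_le t f g : mem_sp (calderon mu N0 N1 t) f ->
  measurable_fun setT g -> {ae mu, forall x, `|g x| <= `|f x|} ->
  mem_sp (calderon mu N0 N1 t) g.
Proof.
move=> /mem_calderonP[mf [K K0 fK]] mg gf; apply/mem_calderonP; split=> //.
by exists K => //; exact: calderon_leW gf.
Qed.

Lemma mem_calderon_lin t (k l : R) f g : 0 < t < 1 ->
  mem_sp (calderon mu N0 N1 t) f -> mem_sp (calderon mu N0 N1 t) g ->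
  mem_sp (calderon mu N0 N1 t) (fun x => k * f x + l * g x).
Proof.
move=> t01 fN gN; have [mf _] := fN; have [mg _] := gN.
have [p [q [pN p0 qN q0 H]]] := mem_calderonE t01 fN.
have [p' [q' [pN' p0' qN' q0' H']]] := mem_calderonE t01 gN.
apply: (@mem_calderon_gm t _ (fun x => `|k| * p x + `|l| * p' x)
  (fun x => `|k| * q x + `|l| * q' x)) => //.
- by apply: measurable_funD; exact: measurable_funM.
- by apply: (mem_spD bl0); exact: (mem_spZ bl0).
- by move=> x; rewrite addr_ge0// mulr_ge0.
- by apply: (mem_spD bl1); exact: (mem_spZ bl1).
- by move=> x; rewrite addr_ge0// mulr_ge0.
apply: filterS2 H H' => x H H'; apply: le_trans (ler_normD _ _) _.
rewrite !normrM.
apply: le_trans (gm_superadd t01 _ _ _ _); rewrite ?mulr_ge0//.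
by rewrite !gmZ// lerD// ler_wpM2l.
Qed.

Lemma mem_calderonZ t (k : R) f : 0 < t < 1 ->
  mem_sp (calderon mu N0 N1 t) f ->
  mem_sp (calderon mu N0 N1 t) (fun x => k * f x).
Proof.
move=> t01 fN; have := mem_calderon_lin k 0 t01 fN fN.
rewrite (_ : (fun x => k * f x + _) = (fun x => k * f x))//.
by apply/funext => x; rewrite mul0r addr0.
Qed.

Lemma mem_calderonB t f g : 0 < t < 1 ->
  mem_sp (calderon mu N0 N1 t) f -> mem_sp (calderon mu N0 N1 t) g ->
  mem_sp (calderon mu N0 N1 t) (fun x => f x - g x).
Proof.
move=> t01 fN gN; have := mem_calderon_lin 1 (-1) t01 fN gN.
rewrite (_ : (fun x => 1 * f x + _) = (fun x => f x - g x))//.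
by apply/funext => x; rewrite mul1r mulN1r.
Qed.

Lemma mem_calderon_pos t : 0 < t < 1 -> exists v,
  [/\ mem_sp (calderon mu N0 N1 t) v, (forall x, 0 <= v x) &
      {ae mu, forall x, 0 < v x}].
Proof.
move=> t01; have [b bb b0] := unit_ball_nonneg_pos bl0.
have [c bc c0] := unit_ball_nonneg_pos bl1.
exists (fun x => gm t (b x) (c x)); split.
- apply: (@mem_calderon_gm t _ b c) => //.
  + by apply: measurable_gm; [case: bb|case: bc].
  + exact: unit_ball_nonneg_mem_sp.
  + by case: bb.
  + exact: unit_ball_nonneg_mem_sp.
  + by case: bc.
  + by apply: aeW => x; rewrite ger0_norm// gm_ge0.
- by move=> x; exact: gm_ge0.
- by apply: filterS2 b0 c0 => x b0 c0; exact: gm_gt0.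
Qed.

Lemma sum_sp_measurable f : sum_sp N0 N1 f -> measurable_fun setT f.
Proof. by move=> [f0 [f1 [[mf0 _] [mf1 _] ->]]]; exact: measurable_funD. Qed.

Lemma sum_sp_dominated f p q : measurable_fun setT f ->
  mem_sp N0 p -> mem_sp N1 q ->
  {ae mu, forall x, `|f x| <= `|p x| + `|q x|} -> sum_sp N0 N1 f.
Proof.
move=> mf pN qN H; have [mp _] := pN; have [mq _] := qN.
have mp' : measurable_fun setT (fun x => `|p x|) by exact: measurableT_comp.
(* Truncating [f] between [-|p|] and [|p|] leaves a remainder bounded by [|q|]. *)
pose f0 x := Num.max (Num.min (f x) `|p x|) (- `|p x|).
have mf0 : measurable_fun setT f0.
  apply: measurable_maxr; last exact: measurableT_comp.
  exact: measurable_minr.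
exists f0, (fun x => f x - f0 x); split.
- apply: (mem_sp_le bl0 mf0 pN); apply: aeW => x.
  rewrite ler_norml le_max lexx orbT/= ge_max ge_min lexx orbT/=.
  by rewrite (@le_trans _ _ 0)// oppr_le0.
- apply: (mem_sp_le bl1 _ qN); first exact: measurable_funB.
  apply: filterS H => x; rewrite /f0 {mf0 f0}.
  have := normr_ge0 (p x); have := normr_ge0 (q x).
  move: (`|p x|) (`|q x|) => a b b0 a0; rewrite !ler_norml => /andP[H1 H2].
  by case: (ltP (f x) a) => ?; [case: (ltP (f x) (- a)) => ?|case: (ltP a (- a)) => ?]; lra.
- by apply/funext => x; rewrite addrC subrK.
Qed.

Lemma sum_sp_le f g : measurable_fun setT f -> sum_sp N0 N1 g ->
  {ae mu, forall x, `|f x| <= `|g x|} -> sum_sp N0 N1 f.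
Proof.
move=> mf [p [q [pN qN ->]]] H; apply: (sum_sp_dominated mf pN qN).
by apply: filterS H => x H; apply: le_trans H (ler_normD _ _).
Qed.

Lemma sum_sp_lin (k l : R) f g : sum_sp N0 N1 f -> sum_sp N0 N1 g ->
  sum_sp N0 N1 (fun x => k * f x + l * g x).
Proof.
move=> [f0 [f1 [fN0 fN1 ->]]] [g0 [g1 [gN0 gN1 ->]]].
exists (fun x => k * f0 x + l * g0 x), (fun x => k * f1 x + l * g1 x); split.
- by apply: (mem_spD bl0); exact: (mem_spZ bl0).
- by apply: (mem_spD bl1); exact: (mem_spZ bl1).
- by apply/funext => x; ring.
Qed.

Lemma sum_spZ (k : R) f : sum_sp N0 N1 f -> sum_sp N0 N1 (fun x => k * f x).
Proof.
move=> fS; have := sum_sp_lin k 0 fS fS.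
rewrite (_ : (fun x => k * f x + _) = (fun x => k * f x))//.
by apply/funext => x; rewrite mul0r addr0.
Qed.

Lemma sum_spB f g : sum_sp N0 N1 f -> sum_sp N0 N1 g ->
  sum_sp N0 N1 (fun x => f x - g x).
Proof.
move=> fS gS; have := sum_sp_lin 1 (-1) fS gS.
rewrite (_ : (fun x => 1 * f x + _) = (fun x => f x - g x))//.
by apply/funext => x; rewrite mul1r mulN1r.
Qed.

Lemma mem_sp0_sum_sp f : mem_sp N0 f -> sum_sp N0 N1 f.
Proof.
move=> fN; have [w [wN _]] : exists w, mem_sp N1 w /\ {ae mu, forall x, 0 < w x}.
  by case: bl1.
by apply: (sum_sp_dominated _ fN wN); [case: fN|apply: aeW => x; rewrite lerDl].
Qed.

Lemma mem_sp1_sum_sp f : mem_sp N1 f -> sum_sp N0 N1 f.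
Proof.
move=> fN; have [w [wN _]] : exists w, mem_sp N0 w /\ {ae mu, forall x, 0 < w x}.
  by case: bl0.
by apply: (sum_sp_dominated _ wN fN); [case: fN|apply: aeW => x; rewrite lerDr].
Qed.

Lemma mem_calderon_sum_sp t f : 0 < t < 1 ->
  mem_sp (calderon mu N0 N1 t) f -> sum_sp N0 N1 f.
Proof.
move=> t01 fN; have [mf _] := fN.
have [p [q [pN p0 qN q0 H]]] := mem_calderonE t01 fN.
apply: (sum_sp_dominated mf pN qN); apply: filterS H => x H.
apply: le_trans H (le_trans (gm_young _ _ _) _) => //.
by rewrite !ger0_norm//; have := p0 x; have := q0 x; nra.
Qed.

Lemma sum_sp_gm t f g : 0 < t < 1 -> sum_sp N0 N1 f -> sum_sp N0 N1 g ->
  (forall x, 0 <= f x) -> (forall x, 0 <= g x) ->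
  sum_sp N0 N1 (fun x => gm t (f x) (g x)).
Proof.
move=> t01 fS gS f0 g0; apply: (sum_sp_le _ (sum_sp_lin (1 - t) t fS gS)).
  by apply: measurable_gm; exact: sum_sp_measurable.
apply: aeW => x; rewrite ger0_norm ?gm_ge0//.
by apply: le_trans (gm_young _ _ _) (ler_norm _).
Qed.
End calderon_space.

Lemma calderon_sym {R : realType} d (T : measurableType d)
    (mu : {measure set T -> \bar R}) (N0 N1 : (T -> R) -> \bar R) t :
  calderon mu N1 N0 (1 - t) = calderon mu N0 N1 t.
Proof.
apply/funext => f; rewrite /calderon; congr (ereal_inf (image _ _)).
apply/seteqP; split=> l /= [l0 [f0 [f1 [? ? ? ? H]]]]; split=> //;
  exists f1, f0; split=> //; apply: filterS H => x;
  by rewrite opprB addrCA subrr addr0 [X in _ * X]mulrC.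
Qed.

Lemma sum_sp_sym {R : realType} d (T : measurableType d)
    (N0 N1 : (T -> R) -> \bar R) : sum_sp N1 N0 = sum_sp N0 N1.
Proof.
apply/funext => f; apply/propext; split=> -[f0 [f1 [? ? ->]]];
  exists f1, f0; split=> //; by apply/funext => x; rewrite addrC.
Qed.

(** * An iteration for the cancellation argument *)

Section iteration.
Context {R : realType}.
Implicit Types (a c : nat -> R).

Lemma powR_prod (I : Type) (r : seq I) (F : I -> R) (p : R) :
  (forall i, 0 <= F i) ->
  \prod_(i <- r) (F i) `^ p = (\prod_(i <- r) F i) `^ p.
Proof.
move=> F0; elim: r => [|i r IH]; first by rewrite !big_nil powR1.
by rewrite !big_cons IH powRM// prodr_ge0.
Qed.

Lemma prod_powR_le_mean a n (p : R) : 0 <= p -> (forall i, 0 <= a i) ->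
  \prod_(i < n.+1) (a i) `^ p <= (((\sum_(i < n.+1) a i) / n.+1%:R) `^ p) ^+ n.+1.
Proof.
move=> p0 a0; rewrite powR_prod//.
have S0 : 0 <= (\sum_(i < n.+1) a i) / n.+1%:R.
  by rewrite divr_ge0// sumr_ge0.
rewrite -powR_mulrn ?powR_ge0// powRAC powR_mulrn//.
apply: ge0_ler_powR; rewrite ?nnegrE ?prodr_ge0 ?exprn_ge0//.
have := @leif_AGM R 'I_n.+1 xpredT (fun i => a i) (fun i _ => a0 i).
by rewrite card_ord => -[].
Qed.

(** Multiplying the hypotheses telescopes: [(a i.+1)^(1 - s * t)] splits off [(a i.+1)^(1 - s)], the
    left factor of the next inequality, so only the end terms keep this exponent. No division
    occurs, hence zero values are harmless. *)
Lemma iterated_product_bound (s t K f : R) a c n : 0 < s < 1 -> 0 < t < 1 ->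
  0 <= K -> 0 <= f -> (forall i, 0 <= a i) -> (forall i, 0 <= c i) ->
  (forall i, gm s (a i) f <= K * gm (s * t) (a i.+1) (c i)) ->
  (a 0%N) `^ (1 - s) * (f `^ s) ^+ n <= K ^+ n * (a n) `^ (1 - s) *
    ((\prod_(i < n) (a i.+1) `^ (s * (1 - t))) * \prod_(i < n) (c i) `^ (s * t)).
Proof.
move=> /andP[s0 s1] /andP[t0 t1] K0 f0 a0 c0 H; elim: n => [|n IH].
  by rewrite !big_ord0 !expr0 !mulr1 mul1r.
rewrite !big_ord_recr/= [in leLHS]exprSr mulrA.
apply: le_trans (ler_wpM2r (powR_ge0 _ _) IH) _.
set P := \prod_(i < n) _; set Q := \prod_(i < n) _.
have P0 : 0 <= P by apply: prodr_ge0 => i _; exact: powR_ge0.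
have Q0 : 0 <= Q by apply: prodr_ge0 => i _; exact: powR_ge0.
have E : (a n.+1) `^ (1 - s * t) = (a n.+1) `^ (1 - s) * (a n.+1) `^ (s * (1 - t)).
  rewrite -powRD; first by congr (_ `^ _); ring.
  have -> : 1 - s + s * (1 - t) = 1 - s * t by ring.
  by rewrite gt_eqF// subr_gt0; nra.
have := ler_wpM2l (mulr_ge0 (exprn_ge0 n K0) (mulr_ge0 P0 Q0)) (H n).
rewrite /gm E exprS; set x := a n `^ _; set y := f `^ _; set z := a n.+1 `^ (1 - s).
set w := a n.+1 `^ _; set v := c n `^ _; move=> H'.
rewrite (_ : _ * x * (P * Q) * y = K ^+ n * (P * Q) * (x * y)); last by ring.
apply: le_trans H' _; rewrite le_eqVlt; apply/orP; left; apply/eqP; ring.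
Qed.

(** The root of order [n.+1] is taken in the product bound. AM-GM turns the products into means, and
    the growth bound on [a] lets the remaining quotient of [a n.+1] by [a 0] contribute at most a
    factor 4. *)
Lemma iterated_mean_bound (s t K f A : R) a c : 0 < s < 1 -> 0 < t < 1 ->
  0 < K -> 0 <= f -> (forall i, 0 <= a i) -> (forall i, 0 <= c i) ->
  (forall i, gm s (a i) f <= K * gm (s * t) (a i.+1) (c i)) ->
  0 <= A -> (forall i, a i <= 2 ^+ i.+1 * A) -> 0 < a 0%N ->
  \forall n \near \oo, f <= (4 * K) `^ s^-1 *
    gm t ((\sum_(i < n.+1) a i.+1) / n.+1%:R) ((\sum_(i < n.+1) c i) / n.+1%:R).
Proof.
move=> s01 t01 K0 f0 a0 c0 H A0 aA a00.
have /andP[s0 s1] := s01; have /andP[t0 t1] := t01.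
have s1' : 0 < 1 - s by rewrite subr_gt0.
have t1' : 0 < 1 - t by rewrite subr_gt0.
(* From this index on, [2 ^+ n.+1] dominates the fixed quotient of [(2 * A)^(1 - s)] by
   [(a 0)^(1 - s)]. *)
pose m := Num.bound ((2 * A) `^ (1 - s) / (a 0%N) `^ (1 - s)).
exists m => // n /= mn.
set B := (\sum_(i < n.+1) a i.+1) / _; set C := (\sum_(i < n.+1) c i) / _.
have B0 : 0 <= B by rewrite divr_ge0// sumr_ge0.
have C0 : 0 <= C by rewrite divr_ge0// sumr_ge0.
have a0p : 0 < (a 0%N) `^ (1 - s) by rewrite powR_gt0.
have Am : (2 * A) `^ (1 - s) <= 2 ^+ n.+1 * (a 0%N) `^ (1 - s).
  rewrite -ler_pdivrMr//; apply: (@le_trans _ _ m%:R).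
    by apply/ltW/archi_boundP; rewrite divr_ge0// powR_ge0.
  rewrite -natrX ler_nat; apply: leq_trans mn _.
  by apply: leq_trans (leqnSn _) _; apply/ltnW; exact: ltn_expl.
(* One factor [2 ^+ n.+1] comes from the growth of [a], the other absorbs [A]. *)
have aN : (a n.+1) `^ (1 - s) <= 2 ^+ n.+1 * (2 ^+ n.+1 * (a 0%N) `^ (1 - s)).
  apply: (@le_trans _ _ ((2 ^+ n.+1 * (2 * A)) `^ (1 - s))).
    apply: ge0_ler_powR; rewrite ?nnegrE ?mulr_ge0 ?exprn_ge0 ?(ltW s1')//.
    by apply: le_trans (aA n.+1) _; rewrite exprSr mulrA.
  rewrite powRM ?mulr_ge0 ?exprn_ge0//; apply: ler_pM; rewrite ?powR_ge0//.
  by apply: ler1_powR; rewrite ?exprn_ege1 ?ler1n// gerBl ltW.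
have := @iterated_product_bound s t K f a c n.+1 s01 t01 (ltW K0) f0 a0 c0 H.
have PB : \prod_(i < n.+1) (a i.+1) `^ (s * (1 - t)) <= (B `^ (s * (1 - t))) ^+ n.+1.
  by apply: (@prod_powR_le_mean (fun i => a i.+1)) => //; rewrite mulr_ge0 ?ltW.
have PC : \prod_(i < n.+1) (c i) `^ (s * t) <= (C `^ (s * t)) ^+ n.+1.
  by apply: prod_powR_le_mean => //; rewrite mulr_ge0 ?ltW.
move=> H1.
have H2 : (f `^ s) ^+ n.+1 <= (4 * K * (B `^ (s * (1 - t)) * C `^ (s * t))) ^+ n.+1.
  rewrite -(ler_pM2l a0p); apply: le_trans H1 _.
  apply: (@le_trans _ _ (K ^+ n.+1 * (2 ^+ n.+1 * (2 ^+ n.+1 * (a 0%N) `^ (1 - s))) *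
    ((B `^ (s * (1 - t))) ^+ n.+1 * (C `^ (s * t)) ^+ n.+1))).
    apply: ler_pM.
    - by rewrite mulr_ge0 ?exprn_ge0 ?powR_ge0// ltW.
    - by rewrite mulr_ge0// prodr_ge0// => i _; exact: powR_ge0.
    - by rewrite ler_wpM2l// exprn_ge0// ltW.
    - by apply: ler_pM => //; apply: prodr_ge0 => i _; exact: powR_ge0.
  rewrite !exprMn (_ : 4 = 2 * 2 :> R); last by ring.
  by rewrite exprMn le_eqVlt; apply/orP; left; apply/eqP; ring.
have H3 : f `^ s <= 4 * K * (B `^ (s * (1 - t)) * C `^ (s * t)).
  move: H2; rewrite ler_pXn2r// nnegrE ?powR_ge0//.
  by rewrite !mulr_ge0 ?powR_ge0 ?ltW.
have sV : 0 <= s^-1 by rewrite invr_ge0 ltW.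
have := @ge0_ler_powR _ _ sV (f `^ s) (4 * K * (B `^ (s * (1 - t)) * C `^ (s * t))).
rewrite !nnegrE powR_ge0 !mulr_ge0 ?powR_ge0 ?(ltW K0)// => /(_ isT isT H3).
rewrite -powRrM mulfV ?gt_eqF// powRr1// => /le_trans; apply.
have K4 : 0 <= 4 * K by rewrite mulr_ge0// ltW.
rewrite (powRM _ K4) ?mulr_ge0 ?powR_ge0//.
rewrite (@powRM _ (B `^ _)) ?powR_ge0// -!powRrM /gm.
by rewrite ![s * _ / s]mulrAC mulfV ?gt_eqF// !mul1r.
Qed.
End iteration.

(** * Positive operators on couples *)

Section operator.
Context {R : realType}.
Context d (S : measurableType d) (mu : {measure set S -> \bar R}).
Context d' (S' : measurableType d') (nu : {measure set S' -> \bar R}).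
Variables (X0 X1 : (S -> R) -> \bar R) (Y0 Y1 : (S' -> R) -> \bar R).
Variable T : (S -> R) -> (S' -> R).
Hypotheses (bX0 : banach_lattice mu X0) (bX1 : banach_lattice mu X1).
Hypotheses (bY0 : banach_lattice nu Y0) (bY1 : banach_lattice nu Y1).
Hypothesis cT : couple_operator mu nu X0 X1 Y0 Y1 T.
Hypothesis pT : positive_op mu nu X0 X1 T.
Implicit Types (f g u : S -> R) (h : S' -> R).

Local Notation sumX := (sum_sp X0 X1).
Local Notation X t := (mem_sp (calderon mu X0 X1 t)).
Local Notation Y t := (mem_sp (calderon nu Y0 Y1 t)).

Lemma T_measurable f : sumX f -> measurable_fun setT (T f).
Proof. by case: cT => + _ _ _ _ => /[apply] /sum_sp_measurable. Qed.

Lemma T_ae f g : sumX f -> sumX g -> {ae mu, forall x, f x = g x} ->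
  {ae nu, forall x, T f x = T g x}.
Proof. by case: cT => _ + _ _ _; exact. Qed.

Lemma T_lin (a b : R) f g : sumX f -> sumX g ->
  {ae nu, forall y, T (fun x => a * f x + b * g x) y = a * T f y + b * T g y}.
Proof. by case: cT => _ _ + _ _; exact. Qed.

Lemma T_scale (a : R) f : sumX f ->
  {ae nu, forall y, T (fun x => a * f x) y = a * T f y}.
Proof.
move=> fS; have := T_lin a 0 fS fS.
rewrite (_ : (fun x => a * f x + 0 * f x) = (fun x => a * f x)); last first.
  by apply/funext => x; rewrite mul0r addr0.
by apply: filterS => y ->; rewrite mul0r addr0.
Qed.

Lemma T_sub f g : sumX f -> sumX g ->
  {ae nu, forall y, T (fun x => f x - g x) y = T f y - T g y}.
Proof.
move=> fS gS; have := T_lin 1 (-1) fS gS.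
rewrite (_ : (fun x => 1 * f x + -1 * g x) = (fun x => f x - g x)); last first.
  by apply/funext => x; rewrite mul1r mulN1r.
by apply: filterS => y ->; rewrite mul1r mulN1r.
Qed.

Lemma T_le f g : sumX f -> sumX g -> {ae mu, forall x, f x <= g x} ->
  {ae nu, forall y, T f y <= T g y}.
Proof.
move=> fS gS fg; have := pT (sum_spB bX0 bX1 gS fS).
have H : ae_nonneg mu (fun x => g x - f x).
  by apply: filterS fg => x; rewrite subr_ge0.
move=> /(_ H); apply: filterS2 (T_sub gS fS) => y ->.
by rewrite subr_ge0.
Qed.

(** A positive linear operator respects each tangent plane of [gm t], and [gm t] is the infimum of
    countably many of them. *)
Lemma T_gm t f g : 0 < t < 1 -> sumX f -> sumX g ->
  (forall x, 0 <= f x) -> (forall x, 0 <= g x) ->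
  {ae nu, forall y, T (fun x => gm t (f x) (g x)) y <= gm t (T f y) (T g y)}.
Proof.
move=> t01 fS gS f0 g0.
have GS := sum_sp_gm bX0 bX1 t01 fS gS f0 g0.
(* An enumeration of the rationals; codes of no rational yield 0, which the condition [0 < q n]
   discards. *)
pose q n : R := ratr (odflt 0 (unpickle n : option rat)).
have H : {ae nu, forall y n, 0 < q n -> T (fun x => gm t (f x) (g x)) y <=
    (1 - t) * q n `^ t * T f y + t * q n `^ (t - 1) * T g y}.
  apply: ae_foralln => n; have [q0|_] := ltP 0 (q n); last by apply: aeW.
  have LS := sum_sp_lin bX0 bX1 ((1 - t) * q n `^ t) (t * q n `^ (t - 1)) fS gS.
  have := T_le GS LS; have Hle : {ae mu, forall x, gm t (f x) (g x) <=
      (1 - t) * q n `^ t * f x + t * q n `^ (t - 1) * g x}.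
    by apply: aeW => x; exact: gm_tangent.
  move=> /(_ Hle).
  have := T_lin ((1 - t) * q n `^ t) (t * q n `^ (t - 1)) fS gS.
  by apply: filterS2 => y ->.
have Tf0 : {ae nu, forall y, 0 <= T f y} by apply: (pT fS); exact: aeW.
have Tg0 : {ae nu, forall y, 0 <= T g y} by apply: (pT gS); exact: aeW.
apply: filterS3 H Tf0 Tg0 => y H fy gy; apply: le_gm_tangents => // r r0.
by have := H (pickle r); rewrite /q pickleK/=; exact.
Qed.

(** [T] sends a majorant [gm t p q] of [|f|] below [gm t (T p) (T q)], and it maps each endpoint
    space into the corresponding one. *)
Lemma T_mem_calderon t f : 0 < t < 1 -> X t f -> Y t (T f).
Proof.
move=> t01 fX; have fS := mem_calderon_sum_sp bX0 bX1 t01 fX.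
have [p [q [pX p0 qX q0 H]]] := mem_calderonE bX0 bX1 t01 fX.
have pS := mem_sp0_sum_sp bX0 bX1 pX; have qS := mem_sp1_sum_sp bX0 bX1 qX.
have GS := sum_sp_gm bX0 bX1 t01 pS qS p0 q0.
case: cT => _ _ _ [C0 /(_ _ pX)[TpY _]] [C1 /(_ _ qX)[TqY _]].
apply: (mem_calderon_gm bY0 bY1 t01 _ (mem_sp_normr bY0 TpY) _ (mem_sp_normr bY1 TqY)).
- exact: T_measurable.
- by move=> y; exact: normr_ge0.
- by move=> y; exact: normr_ge0.
have H1 : {ae nu, forall y, T f y <= T (fun x => gm t (p x) (q x)) y}.
  by apply: T_le => //; apply: filterS H => x; apply: le_trans; exact: ler_norm.
have H2 : {ae nu, forall y, -1 * T f y <= T (fun x => gm t (p x) (q x)) y}.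
  have NS := sum_spZ bX0 bX1 (-1) fS.
  have := T_le NS GS; have H' : {ae mu, forall x, -1 * f x <= gm t (p x) (q x)}.
    by apply: filterS H => x; apply: le_trans; rewrite mulN1r ler_normr lexx orbT.
  by move=> /(_ H'); apply: filterS2 (T_scale (-1) fS) => y ->.
have H12 : {ae nu, forall y, `|T f y| <= T (fun x => gm t (p x) (q x)) y}.
  by apply: filterS2 H1 H2 => y; rewrite mulN1r ler_norml lerNl => -> ->.
have Tp0 : {ae nu, forall y, 0 <= T p y} by apply: (pT pS); exact: aeW.
have Tq0 : {ae nu, forall y, 0 <= T q y} by apply: (pT qS); exact: aeW.
have Tpq : {ae nu, forall y, 0 <= T p y /\ 0 <= T q y}.
  by apply: filterS2 Tp0 Tq0.
apply: filterS3 H12 (T_gm t01 pS qS p0 q0) Tpq => y a b [Tp Tq].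
by rewrite (ger0_norm Tp) (ger0_norm Tq); exact: le_trans b.
Qed.

(** * The inverse at the given parameter [t0] *)

Section inverse.
Hypothesis smu : sigma_finite setT mu.
Hypotheses (fX0 : fatou_property mu X0) (fX1 : fatou_property mu X1).
Hypotheses (fY0 : fatou_property nu Y0) (fY1 : fatou_property nu Y1).
Variable t0 : R.
Hypothesis t001 : 0 < t0 < 1.
Hypothesis iso : order_iso mu nu (calderon mu X0 X1 t0) (calderon nu Y0 Y1 t0) T.

Let X_sum f : X t0 f -> sumX f := @mem_calderon_sum_sp _ _ _ _ _ _ bX0 bX1 t0 f t001.

Lemma iso_le f g : X t0 f -> X t0 g -> {ae nu, forall y, T f y <= T g y} ->
  {ae mu, forall x, f x <= g x}.
Proof.
move=> fX gX fg; case: iso => _ _ _ _ /(_ _ (mem_calderonB bX0 bX1 t001 gX fX)) H.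
have : ae_nonneg nu (T (fun x => g x - f x)).
  apply: filterS2 (T_sub (X_sum gX) (X_sum fX)) fg => y ->.
  by rewrite subr_ge0.
by move=> /H; apply: filterS => x; rewrite subr_ge0.
Qed.

Lemma iso_onto h : Y t0 h ->
  exists2 f, X t0 f & {ae nu, forall y, T f y = h y}.
Proof. by case: iso => _ _ + _ _ => /[apply] -[f [fX fh]]; exists f. Qed.

(* Positivity of the inverse forces its boundedness. *)
Lemma iso_inverse_bounded : exists2 K, 0 < K & forall u p q,
  X t0 u -> (forall x, 0 <= u x) -> unit_ball_nonneg Y0 p -> unit_ball_nonneg Y1 q ->
  {ae nu, forall y, T u y <= gm t0 (p y) (q y)} -> calderon_le mu X0 X1 t0 u K.
Proof.
apply: contrapT => H.
have /choice[F HF] n : exists z : (S -> R) * (S' -> R) * (S' -> R),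
    [/\ X t0 z.1.1, (forall x, 0 <= z.1.1 x), unit_ball_nonneg Y0 z.1.2,
     unit_ball_nonneg Y1 z.2 & {ae nu, forall y, T z.1.1 y <= gm t0 (z.1.2 y) (z.2 y)} /\
     ~ calderon_le mu X0 X1 t0 z.1.1 (4 ^+ n)].
  apply: contrapT => Hn; apply: H; exists (4 ^+ n); first exact: exprn_gt0.
  move=> u p q uX u0 bp bq Tu; apply: contrapT => Hu; apply: Hn.
  by exists (u, p, q).
have Fp n : unit_ball_nonneg Y0 (F n).1.2 by have [] := HF n.
have Fq n : unit_ball_nonneg Y1 (F n).2 by have [] := HF n.
(* [P] and [Q] dominate all factors up to [2 ^+ n.+1], so the preimage [v] of [gm t0 P Q] dominates
   each counterexample up to the same constant. *)
have [P bP Pp] := dominating_element bY0 fY0 Fp.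
have [Q bQ Qq] := dominating_element bY1 fY1 Fq.
have [mP P0 _] := bP; have [mQ Q0 _] := bQ.
have GY : Y t0 (fun y => gm t0 (P y) (Q y)).
  apply: (mem_calderon_gm bY0 bY1 t001 _ (unit_ball_nonneg_mem_sp bP) P0
    (unit_ball_nonneg_mem_sp bQ) Q0); first exact: measurable_gm.
  by apply: aeW => y; rewrite ger0_norm// gm_ge0.
have [v vX Tv] := iso_onto GY.
have /(mem_calderonP bX0 bX1)[_ [K K0 [b [c [bb bc vK]]]]] := vX.
(* For this [n] the bound [2 ^+ n.+1 * K] obtained through [v] is at most [4 ^+ n], which the [n]-th
   counterexample violates. *)
pose n := Num.bound (2 * K).
have Kn : 2 * K <= 2 ^+ n.
  apply: (@le_trans _ _ n%:R).
    by apply/ltW/archi_boundP; rewrite mulr_ge0// ltW.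
  by rewrite -natrX ler_nat ltnW// ltn_expl.
have [uX u0 bp bq [Tu]] := HF n; apply.
have [_ p0 _] := bp; have [_ q0 _] := bq.
set u := (F n).1.1 in uX u0 Tu *.
have v2X := mem_calderonZ bX0 bX1 (2 ^+ n.+1) t001 vX.
have Tuv : {ae nu, forall y, T u y <= T (fun x => 2 ^+ n.+1 * v x) y}.
  have TvG : {ae nu, forall y, T (fun x => 2 ^+ n.+1 * v x) y =
      2 ^+ n.+1 * gm t0 (P y) (Q y)}.
    by apply: filterS2 (T_scale (2 ^+ n.+1) (X_sum vX)) Tv => y -> ->.
  have PQ : {ae nu, forall y, (F n).1.2 y <= 2 ^+ n.+1 * P y /\
      (F n).2 y <= 2 ^+ n.+1 * Q y}.
    by apply: filterS2 Pp Qq => y /(_ n) ? /(_ n) ?; split.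
  apply: filterS3 Tu TvG PQ => y Tu -> [pP qQ]; apply: le_trans Tu _.
  by rewrite -gmZ ?exprn_ge0//; exact: le_gm.
exists b, c; split => //.
apply: filterS2 (iso_le uX v2X Tuv) vK => x uv vK.
rewrite (ger0_norm (u0 x)); apply: le_trans uv _.
apply: (@le_trans _ _ (2 ^+ n.+1 * (K * gm t0 (b x) (c x)))).
  by rewrite ler_wpM2l ?exprn_ge0// (le_trans _ vK)// ler_norm.
rewrite mulrA ler_wpM2r ?gm_ge0//.
rewrite exprSr -mulrA (_ : 4 = 2 * 2); last by ring.
by rewrite exprMn ler_wpM2l// exprn_ge0.
Qed.

Lemma truncation_mem t u v (n : nat) : measurable_fun setT u -> (forall x, 0 <= u x) ->
  0 < t < 1 -> X t v -> (forall x, 0 <= v x) ->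
  X t (fun x => Num.min (u x) (n%:R * v x)).
Proof.
move=> mu_ u0 t01 vX v0; have [mv _] := vX.
have nvX := mem_calderonZ bX0 bX1 n%:R t01 vX.
apply: (mem_calderon_le bX0 bX1 nvX).
  by apply: measurable_minr => //; exact: measurable_funM.
apply: aeW => x; rewrite !ger0_norm ?mulr_ge0//.
  by rewrite ge_min lexx orbT.
by rewrite le_min u0 mulr_ge0.
Qed.

(** Here [u] is only in the sum space. Its truncations by multiples of a positive [v] in [X t0]
    satisfy the bound with one constant, and [calderon_closed] passes to the limit. *)
Lemma lower_estimate_same : exists2 K, 0 < K & forall u p q,
  sumX u -> (forall x, 0 <= u x) -> unit_ball_nonneg Y0 p -> unit_ball_nonneg Y1 q ->
  {ae nu, forall y, T u y <= gm t0 (p y) (q y)} -> calderon_le mu X0 X1 t0 u K.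
Proof.
have [K K0 HK] := iso_inverse_bounded; exists K => // u p q uS u0 bp bq Tu.
have [v [vX v0 vp]] := mem_calderon_pos bX0 bX1 t001.
have mu_ := sum_sp_measurable uS.
pose w (n : nat) x := Num.min (u x) (n%:R * v x).
have w0 n x : 0 <= w n x by rewrite le_min u0 mulr_ge0.
have wX n : X t0 (w n) by exact: truncation_mem.
have wK n : calderon_le mu X0 X1 t0 (w n) K.
  apply: (HK _ _ _ (wX n) (w0 n) bp bq).
  have := T_le (X_sum (wX n)) uS.
  have H : {ae mu, forall x, w n x <= u x} by apply: aeW => x; rewrite ge_min lexx.
  by move=> /(_ H); apply: filterS2 Tu => y Tuy Twy; exact: le_trans Tuy.
have /choice[b /choice[c Hbc]] := wK.
have H n : {ae mu, forall x, w n x / K <= gm t0 (b n x) (c n x)}.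
  have [_ _] := Hbc n; apply: filterS => x; rewrite ger0_norm//.
  by rewrite ler_pdivrMr// mulrC.
have bb n : unit_ball_nonneg X0 (b n) by have [] := Hbc n.
have bc n : unit_ball_nonneg X1 (c n) by have [] := Hbc n.
have [B [C [bB bC HBC]]] := calderon_closed smu bX0 fX0 bX1 fX1 t001 bb bc H.
exists B, C; split => //.
apply: filterS2 HBC vp => x HBC vx; rewrite ger0_norm// mulrC -ler_pdivrMr//.
(* From this index on the truncation [w n] equals [u] at [x]. *)
apply: HBC; exists (Num.bound (u x / v x)) => // n /= nn.
rewrite ler_pM2r ?invr_gt0// /w le_min lexx/= -ler_pdivrMr//.
apply: (@le_trans _ _ (Num.bound (u x / v x))%:R).
  by apply/ltW/archi_boundP; rewrite divr_ge0// ltW.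
by rewrite ler_nat.
Qed.

(** * From [t0] to a larger parameter [t1] *)

Variable t1 : R.
Hypotheses (t0t1 : t0 < t1) (t11 : t1 < 1).

Let t101 : 0 < t1 < 1.
Proof. by have /andP[t00 _] := t001; rewrite (lt_trans t00)//=. Qed.

(** [step] sends [a] in the unit ball of [X0] to a pair of unit ball elements controlling
    [gm s a f]; feeding its first component back produces the sequences required by
    [iterated_mean_bound]. *)
Lemma lower_estimate : exists2 K, 0 < K & forall f h0 h1,
  sumX f -> (forall x, 0 <= f x) ->
  unit_ball_nonneg Y0 h0 -> unit_ball_nonneg Y1 h1 ->
  {ae nu, forall y, T f y <= gm t1 (h0 y) (h1 y)} -> calderon_le mu X0 X1 t1 f K.
Proof.
have /andP[t00 t01'] := t001; have /andP[t10 _] := t101.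
pose s := t0 / t1.
have s01 : 0 < s < 1 by rewrite divr_gt0//= ltr_pdivrMr// mul1r.
have /andP[s0 s1] := s01.
have st : s * t1 = t0 by rewrite /s divfK// gt_eqF.
have [C HC] : exists C : R, forall f, mem_sp X0 f ->
    mem_sp Y0 (T f) /\ (Y0 (T f) <= C%:E * X0 f)%E by case: cT.
(* Bounds the [Y0] norm of [|T a| + h0] for [a] in the unit ball, as well as the [Y1] norm of
   [h1]. *)
pose D := `|C| + 1 + 1; have D0 : 0 < D by rewrite ltr_wpDl// addr_ge0.
have [K0 K00 HK0] := lower_estimate_same.
pose K := D * K0; have Kp : 0 < K by rewrite mulr_gt0.
exists ((4 * K) `^ s^-1); first by rewrite powR_gt0// mulr_gt0.
move=> f h0 h1 fS f0 bh0 bh1 Tf.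
have [mh0 h00 h0N] := bh0; have [mh1 h10 h1N] := bh1.
have step a : unit_ball_nonneg X0 a -> exists bc : (S -> R) * (S -> R),
    [/\ unit_ball_nonneg X0 bc.1, unit_ball_nonneg X1 bc.2 &
    {ae mu, forall x, gm s (a x) (f x) <= K * gm t0 (bc.1 x) (bc.2 x)}].
  move=> ba; have [ma a0 aN] := ba; have aX := unit_ball_nonneg_mem_sp ba.
  have aS := mem_sp0_sum_sp bX0 bX1 aX; have [TaY TaN] := HC _ aX.
  have [mTa _] := TaY.
  have GS := sum_sp_gm bX0 bX1 s01 aS fS a0 f0.
  (* By [gm_gm] the elements [T a] and [h0] of [Y0] combine into one, which leaves a Calderon
     product at [s * t1 = t0]. *)
  pose p y := `|T a y| + h0 y.
  have mp : measurable_fun setT p.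
    by apply: measurable_funD => //; exact: measurableT_comp.
  have p0 y : 0 <= p y by rewrite addr_ge0.
  have pN : (Y0 p <= D%:E)%E.
    apply: le_trans (normD bY0 _ mh0) _; first exact: measurableT_comp.
    rewrite (norm_normr bY0)// /D EFinD; apply: leeD => //.
    apply: le_trans TaN _; apply: (@le_trans _ _ (`|C|%:E * 1)%E); last first.
      by rewrite mule1 lee_fin lerDl.
    apply: (@le_trans _ _ (`|C|%:E * X0 a)%E).
      by apply: lee_wpmul2r; [exact: (norm_ge0 bX0)|rewrite lee_fin ler_norm].
    by apply: lee_wpmul2l.
  have bp := unit_ball_nonnegZ bY0 mp D0 pN.
  have h1D : (Y1 h1 <= D%:E)%E.
    by apply: le_trans h1N _; rewrite lee_fin lerDr addr_ge0.
  have bq := unit_ball_nonnegZ bY1 mh1 D0 h1D.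
  have GS' := sum_spZ bX0 bX1 D^-1 GS.
  have G0' x : 0 <= D^-1 * gm s (a x) (f x) by rewrite mulr_ge0 ?gm_ge0// invr_ge0 ltW.
  have Ta0 : {ae nu, forall y, 0 <= T a y} by apply: (pT aS); exact: aeW.
  have Tf0 : {ae nu, forall y, 0 <= T f y} by apply: (pT fS); exact: aeW.
  have Tfh : {ae nu, forall y, 0 <= T f y <= gm t1 (h0 y) (h1 y)}.
    by apply: filterS2 Tf0 Tf => y -> ->.
  have TG : {ae nu, forall y, T (fun x => gm s (a x) (f x)) y <= gm t0 (p y) (h1 y)}.
    apply: filterS3 (T_gm s01 aS fS a0 f0) Ta0 Tfh => y Tg Tay /andP[Tf0y Tfy].
    apply: le_trans Tg _.
    apply: (@le_trans _ _ (gm s `|T a y| (gm t1 (h0 y) (h1 y)))).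
      by apply: le_gm => //; exact: ler_norm.
    by rewrite -st; exact: gm_gm.
  have TG' : {ae nu, forall y, T (fun x => D^-1 * gm s (a x) (f x)) y <=
      gm t0 (`|p y| / D) (`|h1 y| / D)}.
    apply: filterS2 (T_scale D^-1 GS) TG => y -> TG.
    rewrite ![_ / D]mulrC gmZ ?invr_ge0 ?(ltW D0)// ler_pM2l ?invr_gt0//.
    by rewrite (ger0_norm (p0 y)) (ger0_norm (h10 y)).
  have [b [c [bb bc H]]] := HK0 _ _ _ GS' G0' bp bq TG'.
  exists (b, c); split => //; apply: filterS H => x.
  by rewrite ger0_norm// ler_pdivrMl// mulrA.
(* A dummy value outside the unit ball makes the step total, so that it can be iterated. *)
have /choice[Phi HPhi] a : exists bc : (S -> R) * (S -> R), unit_ball_nonneg X0 a ->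
    [/\ unit_ball_nonneg X0 bc.1, unit_ball_nonneg X1 bc.2 &
    {ae mu, forall x, gm s (a x) (f x) <= K * gm t0 (bc.1 x) (bc.2 x)}].
  have [/step[bc Hbc]|na] := pselect (unit_ball_nonneg X0 a); first by exists bc.
  by exists (a, a).
(* The iteration starts at an almost everywhere positive element because a power of [a 0] gets
   cancelled. *)
have [e be ep] := unit_ball_nonneg_pos bX0.
pose a n := iter n (fun z => (Phi z).1) e.
have ba n : unit_ball_nonneg X0 (a n).
  by elim: n => //= n IH; have [] := HPhi _ IH.
pose c n := (Phi (a n)).2.
have bc n : unit_ball_nonneg X1 (c n) by have [] := HPhi _ (ba n).
have H : {ae mu, forall x n, gm s (a n x) (f x) <= K * gm t0 (a n.+1 x) (c n x)}.
  by apply: ae_foralln => n; have [] := HPhi _ (ba n).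
have [A bA aA] := dominating_element bX0 fX0 ba; have [_ A0 _] := bA.
pose B n x := (\sum_(i < n.+1) a i.+1 x) / n.+1%:R.
pose E n x := (\sum_(i < n.+1) c i x) / n.+1%:R.
have bB n : unit_ball_nonneg X0 (B n).
  exact: (@unit_ball_nonneg_mean _ _ _ mu X0 bX0 (fun i => a i.+1)).
have bE n : unit_ball_nonneg X1 (E n) by exact: (unit_ball_nonneg_mean bX1).
set L := (4 * K) `^ s^-1.
have L0 : 0 < L by rewrite powR_gt0// mulr_gt0.
(* The minimum satisfies the majorisation for every [n], while eventually it equals [f x / L], which
   is what passes to the limit. *)
pose g n x := Num.min (f x / L) (gm t1 (B n x) (E n x)).
have gBE n : {ae mu, forall x, g n x <= gm t1 (B n x) (E n x)}.
  by apply: aeW => x; rewrite ge_min lexx orbT.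
have [B' [C' [bB' bC' HBC]]] := calderon_closed smu bX0 fX0 bX1 fX1 t101 bB bE gBE.
exists B', C'; split => //.
have ep' : {ae mu, forall x, 0 < e x /\ (forall n, a n x <= 2 ^+ n.+1 * A x)}.
  by apply: filterS2 ep aA.
apply: filterS3 HBC H ep' => x HBC H [ex aAx].
rewrite (ger0_norm (f0 x)) mulrC -ler_pdivrMr//; apply: HBC.
have := @iterated_mean_bound _ s t1 K (f x) (A x) (a ^~ x) (c ^~ x) s01 t101 Kp (f0 x).
rewrite st => /(_ _ _ H (A0 x) aAx ex) [|i|k _ Hk].
- by move=> i; have [_ + _] := ba i; exact.
- by have [_ + _] := bc i; exact.
exists k => // n kn; rewrite le_min lexx/= ler_pdivrMr// mulrC.
exact: Hk.
Qed.

(* Order continuity of [T] on [X t1]: it is inherited from [X t0] because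
   [gm t1 p q <= l * gm t0 p q + e * q] with [e] arbitrarily small. *)
Lemma order_continuity f (u : nat -> S -> R) (y : S' -> R) : X t1 f ->
  (forall n, measurable_fun setT (u n)) -> (forall n x, 0 <= u n x) ->
  (forall n, {ae mu, forall x, u n x <= f x}) ->
  {ae mu, forall x r, (forall n, r <= u n x) -> r <= 0} ->
  measurable_fun setT y -> (forall n, {ae nu, forall z, y z <= T (u n) z}) ->
  {ae nu, forall z, y z <= 0}.
Proof.
move=> fX mu_ u0 uf uinf my yT.
have /andP[t00 _] := t001.
have fS := mem_calderon_sum_sp bX0 bX1 t101 fX.
have [p [q [pX p0 qX q0 H]]] := mem_calderonE bX0 bX1 t101 fX.
have qS := mem_sp1_sum_sp bX0 bX1 qX.
have uS n : sumX (u n).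
  apply: (sum_sp_le bX0 bX1 (mu_ n) fS); apply: filterS (uf n) => x ufx.
  by rewrite (ger0_norm (u0 n x)); apply: le_trans ufx (ler_norm _).
pose P x := gm t0 (p x) (q x).
have P0 x : 0 <= P x by exact: gm_ge0.
have PX : X t0 P.
  apply: (mem_calderon_gm bX0 bX1 t001 _ pX p0 qX q0).
    by apply: measurable_gm; [case: pX|case: qX].
  by apply: aeW => x; rewrite ger0_norm.
(* Letting [e] tend to 0 along [1 / n.+1] removes the term with [q]. *)
suff K (e : R) : 0 < e -> {ae nu, forall z, y z <= e * T q z}.
  have : {ae nu, forall z (n : nat), y z <= n.+1%:R^-1 * T q z}.
    by apply: ae_foralln => n; apply: K; rewrite invr_gt0.
  apply: filterS => z Hz; apply/ler_addgt0Pr => e e0; rewrite add0r.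
  pose n := Num.bound (`|T q z| / e).
  apply: le_trans (Hz n) _; rewrite ler_pdivrMl//.
  apply: le_trans (ler_norm _) _; rewrite -ler_pdivrMr//.
  apply: (@le_trans _ _ n%:R); last by rewrite ler_nat.
  by apply/ltW/archi_boundP; rewrite divr_ge0// ltW.
move=> e0; have [l l0 Hl] := gm_split t00 t0t1 t11 e0.
(* Cutting [u n] at [l * P] puts it in [X t0] at the cost of [e * q]. *)
pose w n x := Num.min (u n x) (l * P x).
have lP0 x : 0 <= l * P x by rewrite mulr_ge0// ltW.
have w0 n x : 0 <= w n x by rewrite le_min u0 lP0.
have mlP : measurable_fun setT (fun x => l * P x).
  by apply: measurable_funM => //; case: PX.
have wX n : X t0 (w n).
  have lPX := mem_calderonZ bX0 bX1 l t001 PX.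
  apply: (mem_calderon_le bX0 bX1 lPX); first exact: measurable_minr.
  by apply: aeW => x; rewrite !ger0_norm// ge_min lexx orbT.
have wS n := X_sum (wX n).
have Tq := T_measurable qS.
have Tuw n : {ae nu, forall z, T (u n) z <= 1 * T (w n) z + e * T q z}.
  have LS := sum_sp_lin bX0 bX1 1 e (wS n) qS.
  have Hle : {ae mu, forall x, u n x <= 1 * w n x + e * q x}.
    apply: filterS2 (uf n) H => x ufx fx; rewrite mul1r /w.
    case: (ltP (u n x) (l * P x)) => _.
      by rewrite lerDl mulr_ge0// ltW.
    apply: le_trans ufx (le_trans (ler_norm _) (le_trans fx _)).
    exact: Hl.
  by apply: filterS2 (T_le (uS n) LS Hle) (T_lin 1 e (wS n) qS) => z + <-.
have Tw0 n : {ae nu, forall z, 0 <= T (w n) z} by apply: (pT (wS n)); exact: aeW.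
(* The excess of [y] over [e * T q] lies in [Y t0] below every [T (w n)], so its preimage lies below
   every [w n] and is nonpositive. *)
pose y' z := Num.max (y z - e * T q z) 0.
have y'0 z : 0 <= y' z by rewrite le_max lexx orbT.
have my' : measurable_fun setT y'.
  apply: measurable_maxr => //; apply: measurable_funB => //.
  exact: measurable_funM.
have y'T n : {ae nu, forall z, y' z <= T (w n) z}.
  apply: filterS3 (yT n) (Tuw n) (Tw0 n) => z yz; rewrite mul1r => Tuz Twz.
  by rewrite ge_max Twz andbT lerBlDr; exact: le_trans Tuz.
have y'Y : Y t0 y'.
  apply: (mem_calderon_le bY0 bY1 (T_mem_calderon t001 (wX 0%N)) my').
  apply: filterS (y'T 0%N) => z yz; rewrite (ger0_norm (y'0 z)).
  exact: le_trans yz (ler_norm _).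
have [v vX Tv] := iso_onto y'Y.
have vw : {ae mu, forall x n, v x <= w n x}.
  apply: ae_foralln => n; apply: iso_le => //.
  by apply: filterS2 Tv (y'T n) => z ->.
have v_le0 : {ae mu, forall x, 0 <= -1 * v x}.
  apply: filterS2 vw uinf => x vw uinf; rewrite mulN1r oppr_ge0.
  by apply: uinf => n; apply: le_trans (vw n) _; rewrite ge_min lexx.
have NS := sum_spZ bX0 bX1 (-1) (X_sum vX).
apply: filterS3 (pT NS v_le0) (T_scale (-1) (X_sum vX)) Tv => z Hz Ez Tz.
move: Hz; rewrite Ez Tz mulN1r oppr_ge0 /y' ge_max => /andP[+ _].
by rewrite subr_le0.
Qed.

Lemma onto_nonneg h : Y t1 h -> (forall y, 0 <= h y) ->
  exists2 f, X t1 f & {ae nu, forall y, T f y = h y}.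
Proof.
move=> hY h0; have [mh _] := hY.
have [w [wY w0 wp]] := mem_calderon_pos bY0 bY1 t001.
have [mw _] := wY.
pose hn (n : nat) y := Num.min (h y) (n%:R * w y).
have hn0 n y : 0 <= hn n y by rewrite le_min h0 mulr_ge0.
have hnY n : Y t0 (hn n).
  have nwY := mem_calderonZ bY0 bY1 n%:R t001 wY.
  apply: (mem_calderon_le bY0 bY1 nwY).
    by apply: measurable_minr => //; exact: measurable_funM.
  by apply: aeW => y; rewrite !ger0_norm ?mulr_ge0// ge_min lexx orbT.
have /choice[F HF] n : exists f, [/\ X t0 f, (forall x, 0 <= f x) &
    {ae nu, forall y, T f y = hn n y}].
  have [f fX Tf] := iso_onto (hnY n); have [mf _] := fX.
  (* The preimage is nonnegative only almost everywhere; its positive part is so everywhere. *)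
  pose g x := Num.max (f x) 0.
  have gX : X t0 g.
    apply: (mem_calderon_le bX0 bX1 fX); first exact: measurable_maxr.
    apply: aeW => x; rewrite ger0_norm ?le_max ?lexx ?orbT//.
    by rewrite ge_max ler_norm normr_ge0.
  have fg : {ae mu, forall x, g x = f x}.
    case: iso => _ _ _ _ /(_ _ fX) H.
    have : ae_nonneg nu (T f) by apply: filterS Tf => y ->.
    by move=> /H; apply: filterS => x fx; rewrite /g max_l.
  exists g; split=> //; first by move=> x; rewrite le_max lexx orbT.
  by apply: filterS2 (T_ae (X_sum gX) (X_sum fX) fg) Tf => y -> ->.
have FX n : X t0 (F n) by have [] := HF n.
have F0 n x : 0 <= F n x by have [_ + _] := HF n; exact.
have TF n : {ae nu, forall y, T (F n) y = hn n y} by have [] := HF n.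
have FS : {ae mu, forall x n, F n x <= F n.+1 x}.
  apply: ae_foralln => n; apply: iso_le => //.
  apply: filterS2 (TF n) (TF n.+1) => y -> ->.
  by rewrite le_min !ge_min lexx/= ler_wpM2r ?orbT// ler_nat.
(* [lower_estimate] bounds all [F n] in [X t1] with one constant, and [calderon_closed] replaces the
   varying factors by a single majorant [G]. *)
have [K K0 HK] := lower_estimate.
have /(mem_calderonP bY0 bY1)[_ [L L0 [h0' [h1' [bh0 bh1 hL]]]]] := hY.
have FK n : calderon_le mu X0 X1 t1 (fun x => L^-1 * F n x) K.
  have FSn := X_sum (FX n).
  apply: (HK _ _ _ (sum_spZ bX0 bX1 L^-1 FSn) _ bh0 bh1).
    by move=> x; rewrite mulr_ge0// invr_ge0 ltW.
  apply: filterS3 (T_scale L^-1 FSn) (TF n) hL => y -> -> hL.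
  rewrite ler_pdivrMl//; apply: le_trans hL; rewrite (ger0_norm (h0 y)).
  by rewrite ge_min lexx.
have /choice[b /choice[c Hbc]] := FK.
have bb n : unit_ball_nonneg X0 (b n) by have [] := Hbc n.
have bc n : unit_ball_nonneg X1 (c n) by have [] := Hbc n.
have Fbc n : {ae mu, forall x, F n x / (L * K) <= gm t1 (b n x) (c n x)}.
  have [_ _] := Hbc n; apply: filterS => x.
  rewrite ger0_norm ?mulr_ge0 ?invr_ge0 ?(ltW L0)//.
  by rewrite ler_pdivrMl// ler_pdivrMr ?mulr_gt0// mulrA mulrC.
have [B [C [bB bC HBC]]] := calderon_closed smu bX0 fX0 bX1 fX1 t101 bb bc Fbc.
pose G x := L * K * gm t1 (B x) (C x).
have G0 x : 0 <= G x by rewrite mulr_ge0 ?gm_ge0// ltW// mulr_gt0.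
have mG : measurable_fun setT G.
  apply: measurable_funM => //.
  by apply: measurable_gm; [case: bB|case: bC].
have GX : X t1 G.
  apply/(mem_calderonP bX0 bX1); split=> //; exists (L * K); first exact: mulr_gt0.
  by exists B, C; split => //; apply: aeW => x; rewrite ger0_norm.
have FG : {ae mu, forall x n, F n x <= G x}.
  apply: filterS2 HBC FS => x HBC FS n.
  rewrite /G mulrC -ler_pdivrMr ?mulr_gt0//; apply: HBC; exists n => // m /= nm.
  rewrite ler_pM2r ?invr_gt0 ?mulr_gt0//.
  have /nondecreasing_seqP := FS; exact.
(* Cutting at [G] bounds the sequence at every point, so that the supremum [f] behaves well
   everywhere. *)
pose F' n x := Num.min (F n x) (G x).
have F'0 n x : 0 <= F' n x by rewrite le_min F0 G0.
have mF' n : measurable_fun setT (F' n).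
  by apply: measurable_minr => //; case: (FX n).
have ubF' x : has_ubound (range (F' ^~ x)).
  by exists (G x) => _ [n _ <-]; rewrite ge_min lexx orbT.
pose f x := sups (F' ^~ x) 0.
have F'f n x : F' n x <= f x.
  apply: ub_le_sup; last by exists n.
  by exists (G x) => _ [k _ <-]; rewrite ge_min lexx orbT.
have mf : measurable_fun setT f by exact: measurable_fun_sups.
have f0 x : 0 <= f x by exact: le_trans (F'f 0%N x).
have fG x : f x <= G x.
  apply: ge_sup; first by exists (F' 0%N x), 0%N.
  by move=> _ [k _ <-]; rewrite ge_min lexx orbT.
have fX : X t1 f.
  apply: (mem_calderon_le bX0 bX1 GX mf).
  by apply: aeW => x; rewrite !ger0_norm.
have fS := mem_calderon_sum_sp bX0 bX1 t101 fX.
have F'S n : sumX (F' n).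
  apply: (sum_sp_le bX0 bX1 (mF' n) fS); apply: aeW => x.
  by rewrite !ger0_norm.
have TF' n : {ae nu, forall y, T (F' n) y = hn n y}.
  have EF : {ae mu, forall x, F' n x = F n x}.
    by apply: filterS FG => x /(_ n) FGx; rewrite /F' min_l.
  by apply: filterS2 (T_ae (F'S n) (X_sum (FX n)) EF) (TF n) => y -> ->.
have hTf : {ae nu, forall y, h y <= T f y}.
  have : {ae nu, forall y n, hn n y <= T f y}.
    apply: ae_foralln => n; have := T_le (F'S n) fS.
    have H : {ae mu, forall x, F' n x <= f x} by exact: aeW.
    by move=> /(_ H); apply: filterS2 (TF' n) => y ->.
  apply: filterS2 wp => y wy /(_ (Num.bound (h y / w y))).
  rewrite /hn min_l// -ler_pdivrMr//.
  by apply/ltW/archi_boundP; rewrite divr_ge0.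
(* Order continuity is applied to [f - F' n], with infimum 0; [T f - h] lies below each image
   because [hn n <= h]. *)
have Tfh : {ae nu, forall y, T f y - h y <= 0}.
  apply: (@order_continuity f (fun n x => f x - F' n x)) => //.
  - by move=> n; exact: measurable_funB.
  - by move=> n x; rewrite subr_ge0.
  - by move=> n; apply: aeW => x; rewrite gerBl.
  - apply: aeW => x r Hr; suff : f x <= f x - r by lra.
    apply: ge_sup; first by exists (F' 0%N x), 0%N.
    by move=> _ [k _ <-]; have := Hr k; lra.
  - by apply: measurable_funB => //; exact: T_measurable.
  - move=> n; apply: filterS2 (T_sub fS (F'S n)) (TF' n) => y -> ->.
    by rewrite lerD2l lerN2 ge_min lexx.
exists f => //; apply: filterS2 hTf Tfh => y; rewrite subr_le0 => hy yh.
by apply/eqP; rewrite eq_le hy yh.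
Qed.

(** With [f = fp - fn], a truncation [q] of [fn] in [X t0] has image disjoint from those of the
    truncations [p n] of [fp]. As [T q <= T fn <= T fp], this puts [T q] below [T (fp - p n)] for
    all [n]. Hence [T q <= 0] by order continuity, and positivity of the inverse on [X t0] gives
    [q <= 0]. *)
Lemma inverse_positive f : X t1 f -> ae_nonneg nu (T f) -> ae_nonneg mu f.
Proof.
move=> fX Tf0; have [mf _] := fX.
pose fp x := Num.max (f x) 0; pose fn x := Num.max (- f x) 0.
have fp0 x : 0 <= fp x by rewrite le_max lexx orbT.
have fn0 x : 0 <= fn x by rewrite le_max lexx orbT.
have mfp : measurable_fun setT fp by exact: measurable_maxr.
have mfn : measurable_fun setT fn.
  by apply: measurable_maxr => //; exact: measurableT_comp.
have fpX : X t1 fp.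
  apply: (mem_calderon_le bX0 bX1 fX) => //; apply: aeW => x.
  by rewrite (ger0_norm (fp0 x)) ge_max ler_norm normr_ge0.
have fnX : X t1 fn.
  apply: (mem_calderon_le bX0 bX1 fX) => //; apply: aeW => x.
  by rewrite (ger0_norm (fn0 x)) ge_max -normrN ler_norm normr_ge0.
have fpS := mem_calderon_sum_sp bX0 bX1 t101 fpX.
have fnS := mem_calderon_sum_sp bX0 bX1 t101 fnX.
have [v [vX v0 vp]] := mem_calderon_pos bX0 bX1 t001.
pose q x := Num.min (fn x) (1%:R * v x).
pose p (n : nat) x := Num.min (fp x) (n%:R * v x).
have qX : X t0 q by exact: truncation_mem.
have pX n : X t0 (p n) by exact: truncation_mem.
have p0 n x : 0 <= p n x by rewrite le_min fp0 mulr_ge0.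
have q0 x : 0 <= q x by rewrite le_min fn0 mulr_ge0.
have pf n x : p n x <= fp x by rewrite ge_min lexx.
have Tq0 : {ae nu, forall y, 0 <= T q y} by apply: (pT (X_sum qX)); exact: aeW.
have Tp0 n : {ae nu, forall y, 0 <= T (p n) y}.
  by apply: (pT (X_sum (pX n))); exact: aeW.
(* The preimage of the meet lies below both [q] and [p n], which are never positive at the same
   point. *)
have disj n : {ae nu, forall y, Num.min (T q y) (T (p n) y) <= 0}.
  pose z y := Num.max 0 (Num.min (T q y) (T (p n) y)).
  have mTq := T_measurable (X_sum qX); have mTp := T_measurable (X_sum (pX n)).
  have mz : measurable_fun setT z.
    by apply: measurable_maxr => //; exact: measurable_minr.
  have z0 y : 0 <= z y by rewrite le_max lexx.
  have zq : {ae nu, forall y, z y <= T q y}.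
    by apply: filterS Tq0 => y Tqy; rewrite ge_max Tqy ge_min lexx.
  have zp : {ae nu, forall y, z y <= T (p n) y}.
    by apply: filterS (Tp0 n) => y Tpy; rewrite ge_max Tpy ge_min lexx orbT.
  have zY : Y t0 z.
    apply: (mem_calderon_le bY0 bY1 (T_mem_calderon t001 qX) mz).
    apply: filterS zq => y zqy; rewrite (ger0_norm (z0 y)).
    exact: le_trans zqy (ler_norm _).
  have [a aX Ta] := iso_onto zY.
  have aq : {ae mu, forall x, a x <= q x}.
    by apply: iso_le => //; apply: filterS2 Ta zq => y ->.
  have ap : {ae mu, forall x, a x <= p n x}.
    by apply: iso_le => //; apply: filterS2 Ta zp => y ->.
  have a0 : {ae mu, forall x, 0 <= -1 * a x}.
    apply: filterS2 aq ap => x; rewrite mulN1r oppr_ge0 /q /p /fp /fn.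
    rewrite !le_min !le_max => /andP[/orP[a1|//] _] /andP[/orP[a2|//] _].
    by lra.
  have NS := sum_spZ bX0 bX1 (-1) (X_sum aX).
  apply: filterS3 (pT NS a0) (T_scale (-1) (X_sum aX)) Ta => y Hy Ey Ty.
  by move: Hy; rewrite Ey Ty mulN1r oppr_ge0 /z ge_max => /andP[].
have Tfpn : {ae nu, forall y, T fn y <= T fp y}.
  have Tf' := T_sub fpS fnS.
  have E : (fun x => fp x - fn x) = f.
    apply/funext => x; rewrite /fp /fn.
    by case: (leP (f x) 0) => ?; case: (leP (- f x) 0) => ?; lra.
  by rewrite E in Tf'; apply: filterS2 Tf' Tf0 => y -> ; rewrite subr_ge0.
have Tqn : {ae nu, forall y, T q y <= T fn y}.
  by apply: (T_le (X_sum qX) fnS); apply: aeW => x; rewrite ge_min lexx.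
have Tq_le0 : {ae nu, forall y, T q y <= 0}.
  apply: (@order_continuity fp (fun n x => fp x - p n x)) => //.
  - by move=> n; apply: measurable_funB => //; case: (pX n).
  - by move=> n x; rewrite subr_ge0.
  - by move=> n; apply: aeW => x; rewrite gerBl.
  - apply: filterS vp => x vx r /(_ (Num.bound (fp x / v x))).
    rewrite /p min_l ?subrr// -ler_pdivrMr//.
    by apply/ltW/archi_boundP; rewrite divr_ge0.
  - exact: T_measurable (X_sum qX).
  - move=> n.
    have Tqp : {ae nu, forall y, T q y <= T fp y /\ Num.min (T q y) (T (p n) y) <= 0}.
      by apply: filterS3 Tqn Tfpn (disj n) => y a b; split => //; exact: le_trans b.
    have Tpf : {ae nu, forall y, T (p n) y <= T fp y}.
      by apply: (T_le (X_sum (pX n)) fpS); exact: aeW.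
    apply: filterS3 Tqp (T_sub fpS (X_sum (pX n))) Tpf => y [Tqy +] Ey Tpfy.
    (* If [T q] is nonpositive, [T (p n) <= T fp] suffices; if [T (p n)] is, [T q <= T fp] does. *)
    by rewrite ge_min Ey => /orP[]; lra.
have q_le0 : {ae mu, forall x, 0 <= -1 * q x}.
  case: iso => _ _ _ _; apply; last first.
    by apply: filterS2 (T_scale (-1) (X_sum qX)) Tq_le0 => y ->; rewrite mulN1r oppr_ge0.
  exact: mem_calderonZ.
apply: filterS2 q_le0 vp => x; rewrite mulN1r oppr_ge0 /q mul1r ge_min => /orP[|] + vx.
  by rewrite /fn ge_max oppr_le0 => /andP[].
by rewrite leNgt vx.
Qed.

(** Injectivity is positivity of the inverse at [f - g] and [g - f]; surjectivity follows from
    positive and negative parts. *)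
Lemma order_iso_increase :
  order_iso mu nu (calderon mu X0 X1 t1) (calderon nu Y0 Y1 t1) T.
Proof.
have XS f : X t1 f -> sumX f by exact: mem_calderon_sum_sp.
split.
- split=> [f|a b f g fX gX]; first exact: T_mem_calderon.
  by apply: T_lin; exact: XS.
- move=> f g fX gX Tfg.
  have fgX := mem_calderonB bX0 bX1 t101 fX gX.
  have gfX := mem_calderonB bX0 bX1 t101 gX fX.
  have := inverse_positive fgX; have := inverse_positive gfX.
  have E1 : ae_nonneg nu (T (fun x => f x - g x)).
    by apply: filterS2 (T_sub (XS _ fX) (XS _ gX)) Tfg => y -> ->; rewrite subrr.
  have E2 : ae_nonneg nu (T (fun x => g x - f x)).
    by apply: filterS2 (T_sub (XS _ gX) (XS _ fX)) Tfg => y -> ->; rewrite subrr.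
  move=> /(_ E2) H2 /(_ E1); apply: filterS2 H2 => x; rewrite !subr_ge0 => a b.
  by apply/eqP; rewrite eq_le a b.
- move=> h hY; have [mh _] := hY.
  pose hp y := Num.max (h y) 0; pose hn y := Num.max (- h y) 0.
  have hp0 x : 0 <= hp x by rewrite le_max lexx orbT.
  have hn0 x : 0 <= hn x by rewrite le_max lexx orbT.
  have hpY : Y t1 hp.
    apply: (mem_calderon_le bY0 bY1 hY); first exact: measurable_maxr.
    by apply: aeW => x; rewrite (ger0_norm (hp0 x)) ge_max ler_norm normr_ge0.
  have hnY : Y t1 hn.
    apply: (mem_calderon_le bY0 bY1 hY).
      by apply: measurable_maxr => //; exact: measurableT_comp.
    by apply: aeW => x; rewrite (ger0_norm (hn0 x)) ge_max -normrN ler_norm normr_ge0.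
  have [f fX Tf] := onto_nonneg hpY hp0; have [g gX Tg] := onto_nonneg hnY hn0.
  exists (fun x => f x - g x); split; first exact: mem_calderonB.
  apply: filterS3 (T_sub (XS _ fX) (XS _ gX)) Tf Tg => y -> -> ->.
  rewrite /hp /hn.
  by case: (leP (h y) 0) => ?; case: (leP (- h y) 0) => ?; lra.
- by move=> f fX; apply: pT; exact: XS.
- by move=> f fX; exact: inverse_positive.
Qed.
End inverse.
End operator.

(** * Symmetry in the parameter and the two directions *)

Theorem theorem5p1 (R : realType)
  (d : measure_display) (S : measurableType d) (mu : {measure set S -> \bar R})
  (d' : measure_display) (S' : measurableType d') (nu : {measure set S' -> \bar R})
  (X0 X1 : (S -> R) -> \bar R) (Y0 Y1 : (S' -> R) -> \bar R)
  (T : (S -> R) -> (S' -> R)) (theta0 : R) :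
  sigma_finite setT mu -> sigma_finite setT nu ->
  banach_lattice mu X0 -> fatou_property mu X0 ->
  banach_lattice mu X1 -> fatou_property mu X1 ->
  banach_lattice nu Y0 -> fatou_property nu Y0 ->
  banach_lattice nu Y1 -> fatou_property nu Y1 ->
  couple_operator mu nu X0 X1 Y0 Y1 T -> positive_op mu nu X0 X1 T ->
  0 < theta0 < 1 ->
  order_iso mu nu (calderon mu X0 X1 theta0) (calderon nu Y0 Y1 theta0) T ->
  forall theta1 : R, 0 < theta1 < 1 ->
  order_iso mu nu (calderon mu X0 X1 theta1) (calderon nu Y0 Y1 theta1) T.
Proof.
move=> smu _ bX0 fX0 bX1 fX1 bY0 fY0 bY1 fY1 cT pT t001 iso t1 t101.
have [lt01|lt10|<-//] := ltgtP theta0 t1.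
  have /andP[_ t11] := t101.
  exact: (order_iso_increase bX0 bX1 bY0 bY1 cT pT smu fX0 fX1 fY0 fY1 t001 iso).
(* Exchanging the endpoint spaces replaces each parameter [t] by [1 - t], which reverses the order
   of the two parameters. *)
have cT' : couple_operator mu nu X1 X0 Y1 Y0 T.
  by case: cT => *; split; rewrite ?[sum_sp X1 X0]sum_sp_sym ?[sum_sp Y1 Y0]sum_sp_sym.
have pT' : positive_op mu nu X1 X0 T by rewrite /positive_op sum_sp_sym.
rewrite -[calderon mu X0 X1 t1]calderon_sym -[calderon nu Y0 Y1 t1]calderon_sym.
apply: (@order_iso_increase _ _ _ _ _ _ _ _ _ _ _ _ bX1 bX0 bY1 bY0 cT' pT' smu
  fX1 fX0 fY1 fY0 (1 - theta0)).
- by have /andP[] := t001; lra.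
- by rewrite !calderon_sym.
- by lra.
- by have /andP[] := t101; lra.
Qed.
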